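(* Let $U$ be a real Banach space with dual $U^\ast$. (a) A cylindrical probability measure $\mu$ on $\mathcal{Z}(U)$ is infinitely divisible if and only if it is weakly infinitely divisible. (b) A Radon probability measure $\mu$ on $\mathcal{B}(U)$ is infinitely divisible if and only if $\mu\circ\pi_{a_1,\dots,a_n}^{-1}$ is an infinitely divisible probability measure on $\mathcal{B}(\mathbb{R}^n)$ for all $a_1,\dots,a_n\in U^\ast$ and all $n\in\mathbb{N}$.
   Context: $\langle u,a\rangle$ is the dual pairing of $u\in U$, $a\in U^\ast$. For $a_1,\dots,a_n\in U^\ast$ let $\pi_{a_1,\dots,a_n}:U\to\mathbb{R}^n$, $\pi_{a_1,\dots,a_n}(u)=(\langle u,a_1\rangle,\dots,\langle u,a_n\rangle)$. For $\Gamma\subseteq U^\ast$, $\mathcal{Z}(U,\Gamma)$ is the algebra of cylindrical sets $\pi_{a_1,\dots,a_n}^{-1}(B)$ with $n\in\mathbb{N}$, $a_1,\dots,a_n\in\Gamma$, $B\in\mathcal{B}(\mathbb{R}^n)$; $\mathcal{C}(U,\Gamma)$ is the $\sigma$-algebra it generates; $\mathcal{Z}(U):=\mathcal{Z}(U,U^\ast)$. A cylindrical measure is a function $\mu:\mathcal{Z}(U)\to[0,\infty]$ whose restriction to $\mathcal{C}(U,\Gamma)$ is a measure for every finite $\Gamma\subseteq U^\ast$; it is a cylindrical probability measure if $\mu(U)=1$. The convolution $\mu_1\ast\mu_2$ of cylindrical probability measures is given by $(\mu_1\ast\mu_2)(\pi_{a_1,\dots,a_n}^{-1}(B))=\big((\mu_1\circ\pi_{a_1,\dots,a_n}^{-1})\ast(\mu_2\circ\pi_{a_1,\dots,a_n}^{-1})\big)(B)$,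 and $\mu^{\ast k}$ is the $k$-fold convolution of $\mu$ with itself. A cylindrical probability measure $\mu$ on $\mathcal{Z}(U)$ is infinitely divisible if for each $k\in\mathbb{N}$ there is a cylindrical probability measure $\mu_k$ with $\mu=(\mu_k)^{\ast k}$. It is weakly infinitely divisible if $\mu\circ\pi_{a_1,\dots,a_n}^{-1}$ is an infinitely divisible probability measure on $\mathcal{B}(\mathbb{R}^n)$ for all $a_1,\dots,a_n\in U^\ast$ and $n\in\mathbb{N}$. A Radon probability measure $\mu$ on the Borel $\sigma$-algebra $\mathcal{B}(U)$ is infinitely divisible if for each $k\in\mathbb{N}$ there is a Radon probability measure $\mu_k$ on $\mathcal{B}(U)$ with $\mu=(\mu_k)^{\ast k}$. *)

(* Defs.v *)
From HB Require Import structures.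
From mathcomp Require Import all_boot all_order all_algebra.
From mathcomp Require Import all_classical all_reals all_analysis.
From mathcomp Require Import measurable_realfun.
Import Order.TTheory GRing.Theory Num.Theory numFieldNormedType.Exports.

Set Implicit Arguments.
Unset Strict Implicit.
Unset Printing Implicit Defensive.

Local Open Scope classical_set_scope.
Local Open Scope ring_scope.
Local Open Scope ereal_scope.

Notation borel T := (g_sigma_algebraType (@open T)).

Lemma measurable_fun_borel (T1 T2 : ptopologicalType) (f : T1 -> T2) :
  continuous f -> measurable_fun [set: borel T1] (f : borel T1 -> borel T2).
Proof.
move=> /continuousP cf; apply: (@measurability _ _ (borel T1) (borel T2) setT f (@open T2)) => //.
move=> _ [B oB <-]; rewrite setTI; apply: sub_sigma_algebra; exact: cf.
Qed.

Section convolution_generic.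
Context d (T : measurableType d) (R : realType) (add : T -> T -> T).
Variables m1 m2 : {measure set T -> \bar R}.
Hypothesis mtranslate : forall A (y : T), measurable A ->
  measurable [set x | A (add x y)].
Hypothesis mtranslate_measure : forall A, measurable A ->
  measurable_fun [set: T] (fun y : T => m1 [set x | A (add x y)] : \bar R).

Definition gconvolution (A : set T) : \bar R :=
  \int[m2]_y m1 [set x | A (add x y)].

Lemma gconvolution0 : gconvolution set0 = 0.
Proof.
rewrite /gconvolution -[RHS](integral0 m2 setT); apply: eq_integral => y _.
by rewrite (_ : [set x | _] = set0) ?measure0//.
Qed.

Lemma gconvolution_ge0 A : 0 <= gconvolution A.
Proof. exact: integral_ge0. Qed.

Lemma gconvolution_sigma_additive : semi_sigma_additive gconvolution.
Proof.
move=> F mF tF mUF.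
have -> : gconvolution (\bigcup_n F n) = \sum_(n <oo) gconvolution (F n).
  rewrite /gconvolution -integral_nneseries//; last first.
    by move=> n; exact: mtranslate_measure.
  apply: eq_integral => y _; apply/esym/cvg_lim => //.
  have -> : [set x | (\bigcup_n F n) (add x y)] =
      \bigcup_n [set x | F n (add x y)] by [].
  apply: (@measure_semi_sigma_additive _ _ _ m1).
  - by move=> n; exact: mtranslate.
  - move=> i j _ _ [x /= [xi xj]]; apply: tF => //.
    by exists (add x y).
  - by apply: bigcupT_measurable => n; exact: mtranslate.
by apply: is_cvg_nneseries => n _ _; exact: gconvolution_ge0.
Qed.

End convolution_generic.

Section convolution.
Context (R : realType) (V : normedModType R).
Implicit Types mu : probability (borel V) R.

Lemma measurable_translate (A : set (borel V)) (y : V) :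
  measurable A -> measurable ([set x : V | A (x + y)%R] : set (borel V)).
Proof.
move=> mA.
have cf : continuous (fun x : V => (x + y)%R).
  by move=> x; apply: cvgD; [exact: cvg_id|exact: cvg_cst].
have := measurable_fun_borel cf measurableT mA.
by rewrite setTI.
Qed.

Lemma lower_semicontinuous_translate mu (A : set V) : open A ->
  lower_semicontinuous (fun y : V => mu [set x : V | A (x + y)%R]).
Proof.
move=> oA y a ay.
pose F n : set V := ~` \bigcup_(z in ~` A) ball z (n.+1%:R^-1)%R.
pose G n : set (borel V) := [set x : V | F n (x + y)%R].
have mF n : measurable (F n : set (borel V)).
  apply: measurableC; apply: sub_sigma_algebra.
  by apply: bigcup_open => z _; exact: ball_open.
have mG n : measurable (G n) by exact: measurable_translate.
have GA : \bigcup_n G n = [set x : V | A (x + y)%R].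
  apply/seteqP; split => [x [n _]|x /= Axy].
    rewrite /G /F /= => Fxy; apply: contrapT => nA; apply: Fxy.
    by exists (x + y)%R => //; exact: ballxx.
  have /nbhs_ballP[e /= e0 eA] : nbhs (x + y)%R A by exact: open_nbhs_nbhs.
  exists (Num.truncn e^-1) => // -[z nAz zxy]; apply/nAz/eA.
  apply/ball_sym; apply: le_ball zxy.
  by rewrite invf_ple ?posrE// ltW// truncnS_gt.
have ndG : nondecreasing_seq G.
  move=> n m nm; apply/subsetPset => x Gx [z nAz zx]; apply: Gx.
  exists z => //; apply: le_ball zx.
  by rewrite lef_pV2 ?posrE// ler_nat.
have := nondecreasing_cvg_mu (mu := mu) mG (bigcupT_measurable _ mG) ndG.
rewrite GA => cG.
have [n an] : exists n, a%:E < mu (G n).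
  have /cG[N _ aN] := open_ereal_gt' ay.
  by exists N; exact: (aN N (leqnn N)).
exists (ball y (n.+1%:R^-1)%R); first exact: nbhsx_ballx.
move=> y' yy'; apply: (lt_le_trans an); apply: le_measure; rewrite ?inE//.
  by apply: measurable_translate; exact: sub_sigma_algebra.
move=> x Gx /=; apply: contrapT => nA; apply: Gx.
exists (x + y')%R => //; move: yy'; rewrite -!ball_normE /= distrC.
by rewrite opprD addrACA subrr add0r.
Qed.

Lemma measurable_translate_measure mu (A : set (borel V)) : measurable A ->
  measurable_fun [set: borel V] (fun y : V => mu [set x : V | A (x + y)%R]).
Proof.
move: A; apply: (@dynkin_induction _ (borel V) (@open V)) => //.
- by move=> A B; exact: openI.
- rewrite (_ : (fun _ => _) = cst (mu setT))//; exact: measurable_cst.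
- move=> A oA; apply: (measurability _ (ErealGenOInfty.measurableE R)).
  move=> /= _ [_ [a ->]] <-; apply: measurableI => //; apply: sub_sigma_algebra.
  rewrite preimage_itvoy; move: a.
  by apply/lower_semicontinuousP; exact: lower_semicontinuous_translate.
- move=> A mA mfA.
  rewrite (_ : (fun _ => _) = fun y => 1 - mu [set x : V | A (x + y)%R]).
    by apply: emeasurable_funB => //; exact: measurable_cst.
  apply/funext => y; rewrite -probability_setC//.
  exact: measurable_translate.
- move=> F mF tF mfF.
  rewrite (_ : (fun _ => _) =
      fun y => \sum_(n <oo) mu [set x : V | F n (x + y)%R]).
    exact: ge0_emeasurable_sum.
  apply/funext => y; apply/esym/cvg_lim => //.
  rewrite (_ : [set x | _] = \bigcup_n [set x : V | F n (x + y)%R])//.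
  apply: measure_semi_sigma_additive.
  - by move=> n; exact: measurable_translate.
  - by move=> i j _ _ [x /= [xi xj]]; apply: tF => //; exists (x + y)%R.
  - by apply: bigcupT_measurable => n; exact: measurable_translate.
Qed.

Variables mu1 mu2 : probability (borel V) R.

(* (mu1 * mu2)(A) is the integral of mu1(A - y) against mu2(dy). This avoids the
   product measure mu1 \x mu2, which does not live on the Borel sets of V * V,
   and for which addition need not be measurable, when V is not separable. The
   integrand is Borel by measurable_translate_measure. *)
Definition convolution (A : set (borel V)) : \bar R :=
  \int[mu2]_y mu1 [set x : V | A (x + y)%R].

Let convolution0 : convolution set0 = 0.
Proof. exact: gconvolution0. Qed.

Let convolution_ge0 A : 0 <= convolution A.
Proof. exact: gconvolution_ge0. Qed.

Let convolution_sigma_additive : semi_sigma_additive convolution.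
Proof.
apply: (@gconvolution_sigma_additive _ (borel V) R (fun x y : V => (x + y)%R)).
- by move=> A y; exact: measurable_translate.
- by move=> A; exact: measurable_translate_measure.
Qed.

HB.instance Definition _ := isMeasure.Build _ _ _ convolution
  convolution0 convolution_ge0 convolution_sigma_additive.

Let convolution_setT : convolution setT = 1.
Proof.
rewrite /convolution (eq_integral (cst 1)); last first.
  by move=> y _; rewrite -(probability_setT mu1).
by rewrite integral_cst// mul1e; exact: (probability_setT mu2).
Qed.

HB.instance Definition _ :=
  Measure_isProbability.Build _ _ _ convolution convolution_setT.

End convolution.

Section infinite_divisibility.
Context (R : realType) (V : normedModType R).

(* The k-fold convolution of mu with itself, for 0 < k. *)
Definition convolution_power (k : nat) (mu : probability (borel V) R) :
    probability (borel V) R :=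
  iter k.-1 (fun nu : probability (borel V) R =>
    convolution nu mu : probability (borel V) R) mu.

(* Measures of the library are total set functions, hence the comparison on
   measurable sets only. *)
Definition infinitely_divisible (mu : probability (borel V) R) :=
  forall k, (0 < k)%N -> exists mu_k : probability (borel V) R,
    forall A : set (borel V), measurable A -> mu A = convolution_power k mu_k A.

Definition radon (mu : probability (borel V) R) :=
  forall A : set (borel V), measurable A -> forall e : R, (0 < e)%R ->
    exists K : set V, [/\ compact K, K `<=` A & mu (A `\` K) < e%:E].

Definition radon_infinitely_divisible (mu : probability (borel V) R) :=
  forall k, (0 < k)%N -> exists mu_k : probability (borel V) R, radon mu_k /\
    forall A : set (borel V), measurable A -> mu A = convolution_power k mu_k A.

End infinite_divisibility.

Section cylindrical.
Context (R : realType) (U : normedModType R).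

Definition dual := {a : {linear U -> R^o} | continuous a}.

Definition dual_proj n (a : 'I_n -> dual) (u : U) : 'rV[R]_n :=
  \row_i sval (a i) u.

(* The case n = 0 is allowed; it only contributes the sets set0 and setT. *)
Definition cylinder (G : set dual) : set (set U) :=
  [set Z | exists n (a : 'I_n -> dual) (B : set (borel 'rV[R]_n)),
    [/\ forall i, G (a i), measurable B & Z = dual_proj a @^-1` B]].

(* Only the values on cylinder setT are meaningful: as for the measures of the
   library, the function is nonnegative on all sets but otherwise arbitrary
   outside its domain, and two cylindrical measures are to be compared on
   cylinder setT only. *)
Record cylindrical_probability := CylindricalProbability {
  cylindrical_fun :> set U -> \bar R ;
  cylindrical_ge0 : forall Z, 0 <= cylindrical_fun Z ;
  cylindrical_measure : forall G : set dual, finite_set G ->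
    exists m : {measure set (g_sigma_algebraType (cylinder G)) -> \bar R},
      forall Z, (cylinder G).-sigma.-measurable Z -> cylindrical_fun Z = m Z ;
  cylindrical_setT : cylindrical_fun setT = 1 }.

Lemma row_continuous (T : topologicalType) n (f : T -> 'rV[R]_n) :
  (forall i, continuous (fun x => f x ord0 i)) -> continuous f.
Proof.
move=> cf x A [P fP PA].
have : \forall y \near x, forall i, P ord0 i (f y ord0 i).
  by apply: filter_forall => i; apply: cf; exact: fP.
apply: filterS => y Py; apply: PA => i j.
by rewrite !ord1 in Py *; exact: Py.
Qed.

Lemma dual_proj_continuous n (a : 'I_n -> dual) : continuous (dual_proj a).
Proof.
apply: row_continuous => i; rewrite /dual_proj.
by under eq_fun do rewrite mxE; exact: svalP (a i).
Qed.

(* dual_proj, retyped so that it is recognized as a Borel random variable. *)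
Definition borel_proj n (a : 'I_n -> dual) : borel U -> borel 'rV[R]_n :=
  dual_proj a.

HB.instance Definition _ n (a : 'I_n -> dual) :=
  @isMeasurableFun.Build _ _ (borel U) (borel 'rV[R]_n) (borel_proj a)
    (measurable_fun_borel (@dual_proj_continuous n a)).

Lemma dual_projD n (a : 'I_n -> dual) u v :
  dual_proj a (u + v)%R = (dual_proj a u + dual_proj a v)%R.
Proof. by apply/rowP => i; rewrite !mxE linearD. Qed.

Lemma cylinder_measurable (G : set dual) n (a : 'I_n -> dual)
    (B : set (borel 'rV[R]_n)) :
  (forall i, G (a i)) -> measurable B ->
  (cylinder G).-sigma.-measurable (dual_proj a @^-1` B).
Proof. by move=> Ga mB; apply: sub_sigma_algebra; exists n, a, B. Qed.

Lemma finite_dual_range (G : set dual) : finite_set G ->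
  exists n (e : 'I_n -> dual), G = range e.
Proof.
move=> [n /card_esym/card_bijP[f [g fK gK]]].
exists n, (fun i => val (f (exist _ (nat_of_ord i) (mem_set (ltn_ord i))))).
apply/seteqP; split => [x Gx|_ [i _ <-]]; last exact: set_valP.
have := gK (exist _ x (mem_set Gx)).
case: (g _) => i iP fi; have in_ := set_mem iP.
exists (Ordinal in_) => //.
rewrite -[x]/(val (exist _ x (mem_set Gx) : G)) -fi; congr (val (f _)).
exact: val_inj.
Qed.

Lemma cylinder_sigmaE n (e : 'I_n -> dual) Z :
  (cylinder (range e)).-sigma.-measurable Z ->
  exists2 B : set (borel 'rV[R]_n), measurable B & Z = dual_proj e @^-1` B.
Proof.
suff : (cylinder (range e)).-sigma.-measurable `<=`
    preimage_set_system setT (dual_proj e) (@measurable _ (borel 'rV[R]_n)).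
  by move=> /[apply] -[B mB <-]; exists B => //; rewrite setTI.
apply: smallest_sub.
  by apply: sigma_algebra_preimage; exact: sigma_algebra_measurable.
move=> _ [m [a [B [ea mB ->]]]].
have /choice[s sE] : forall i, exists j, e j = a i.
  by move=> i; have [j _ <-] := ea i; exists j.
pose sel (v : 'rV[R]_n) : 'rV[R]_m := \row_i v ord0 (s i).
have csel : continuous sel.
  apply: row_continuous => i; rewrite /sel.
  by under eq_fun do rewrite mxE; exact: coord_continuous.
exists (sel @^-1` B).
  by rewrite -[X in measurable X]setTI; exact: measurable_fun_borel.
rewrite setTI -comp_preimage; congr (_ @^-1` B); apply/funext => u /=.
by apply/rowP => i; rewrite !mxE sE.
Qed.

Section image.
Variables (mu : cylindrical_probability) (n : nat) (a : 'I_n -> dual).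

Definition cylindrical_image (B : set (borel 'rV[R]_n)) : \bar R :=
  mu (dual_proj a @^-1` B).

Let rangea : finite_set (range a).
Proof. exact: finite_image. Qed.

Let image0 : cylindrical_image set0 = 0.
Proof.
have [m mE] := cylindrical_measure mu rangea.
by rewrite /cylindrical_image preimage_set0 mE// measure0.
Qed.

Let image_ge0 B : 0 <= cylindrical_image B.
Proof. exact: cylindrical_ge0. Qed.

Let image_sigma_additive : semi_sigma_additive cylindrical_image.
Proof.
have [m mE] := cylindrical_measure mu rangea.
have mimage (B : set (borel 'rV[R]_n)) : measurable B -> (cylinder (range a)).-sigma.-measurable
    (dual_proj a @^-1` B).
  by move=> mB; apply: cylinder_measurable => // i; exists i.
move=> F mF tF mUF; rewrite /cylindrical_image mE; last exact: mimage.
rewrite (_ : (fun _ => _) =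
    fun k => \sum_(0 <= i < k) m (dual_proj a @^-1` F i)); last first.
  by apply/funext => k; apply: eq_bigr => i _; rewrite mE//; exact: mimage.
rewrite preimage_bigcup; apply: measure_semi_sigma_additive.
- by move=> i; exact: mimage.
- by move=> i j _ _ [x [xi xj]]; apply: tF => //; exists (dual_proj a x).
- by rewrite -preimage_bigcup; exact: mimage.
Qed.

HB.instance Definition _ := isMeasure.Build _ _ _ cylindrical_image
  image0 image_ge0 image_sigma_additive.

Let image_setT : cylindrical_image setT = 1.
Proof. exact: cylindrical_setT. Qed.

HB.instance Definition _ :=
  Measure_isProbability.Build _ _ _ cylindrical_image image_setT.

End image.

Lemma convolution_image (mu1 mu2 : cylindrical_probability) (G : set dual)
    (m2 : {measure set (g_sigma_algebraType (cylinder G)) -> \bar R})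
    n (a : 'I_n -> dual) (B : set (borel 'rV[R]_n)) :
  (forall Z, (cylinder G).-sigma.-measurable Z -> mu2 Z = m2 Z) ->
  (forall i, G (a i)) -> measurable B ->
  convolution (cylindrical_image mu1 a) (cylindrical_image mu2 a) B =
  \int[m2]_w mu1 [set u : U | (dual_proj a @^-1` B) (u + w)%R].
Proof.
move=> m2E Ga mB; rewrite /convolution.
have mproj : measurable_fun setT
    (dual_proj a : g_sigma_algebraType (cylinder G) -> borel 'rV[R]_n).
  by move=> _ C mC; rewrite setTI; exact: cylinder_measurable.
transitivity (\int[pushforward m2 (dual_proj a : g_sigma_algebraType (cylinder G) -> borel 'rV[R]_n)]_y
    cylindrical_image mu1 a [set x : 'rV[R]_n | B (x + y)%R]).
  apply: eq_measure_integral => C mC _.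
  by rewrite /= /cylindrical_image m2E//; exact: cylinder_measurable.
rewrite ge0_integral_pushforward//=.
- rewrite preimage_setT; apply: eq_integral => w _ /=.
  rewrite /cylindrical_image; congr (mu1 _).
  by apply/seteqP; split => u /=; rewrite dual_projD.
- exact: measurable_translate_measure.
Qed.

Lemma convolution_image_uniq (mu1 mu2 : cylindrical_probability)
    n (a : 'I_n -> dual) (A : set (borel 'rV[R]_n))
    m (b : 'I_m -> dual) (B : set (borel 'rV[R]_m)) :
  measurable A -> measurable B -> dual_proj a @^-1` A = dual_proj b @^-1` B ->
  convolution (cylindrical_image mu1 a) (cylindrical_image mu2 a) A =
  convolution (cylindrical_image mu1 b) (cylindrical_image mu2 b) B.
Proof.
move=> mA mB AB.
have fab : finite_set (range a `|` range b).
  by rewrite finite_setU; split; exact: finite_image.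
have [m2 m2E] := cylindrical_measure mu2 fab.
rewrite (convolution_image _ m2E)//; last by move=> i; left; exists i.
rewrite (convolution_image _ m2E)//; last by move=> i; right; exists i.
by rewrite AB.
Qed.

Lemma cylindrical_convolution_exists (mu1 mu2 : cylindrical_probability) :
  exists nu : cylindrical_probability,
    forall n (a : 'I_n -> dual) (B : set (borel 'rV[R]_n)), measurable B ->
      nu (dual_proj a @^-1` B) =
      convolution (cylindrical_image mu1 a) (cylindrical_image mu2 a) B.
Proof.
pose P (Z : set U) (x : \bar R) :=
  exists n (a : 'I_n -> dual) (B : set (borel 'rV[R]_n)),
    [/\ measurable B, Z = dual_proj a @^-1` B &
      x = convolution (cylindrical_image mu1 a) (cylindrical_image mu2 a) B].
pose nu (Z : set U) : \bar R := xget 0 [set x | P Z x].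
have nuE n (a : 'I_n -> dual) (B : set (borel 'rV[R]_n)) : measurable B ->
    nu (dual_proj a @^-1` B) =
    convolution (cylindrical_image mu1 a) (cylindrical_image mu2 a) B.
  move=> mB; apply: xget_unique; first by exists n, a, B.
  by move=> _ [m [b [C [mC BC ->]]]]; exact: convolution_image_uniq.
have nu_ge0 Z : 0 <= nu Z.
  by rewrite /nu; case: xgetP => // _ _ [n [a [B [_ _ ->]]]].
have nu_measure (G : set dual) : finite_set G ->
    exists m : {measure set (g_sigma_algebraType (cylinder G)) -> \bar R},
      forall Z, (cylinder G).-sigma.-measurable Z -> nu Z = m Z.
  move=> fG.
  have [m1 m1E] := cylindrical_measure mu1 fG.
  have [m2 m2E] := cylindrical_measure mu2 fG.
  have [n [e GE]] := finite_dual_range fG.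
  have Ge i : G (e i) by rewrite GE; exists i.
  have sigmaE Z : (cylinder G).-sigma.-measurable Z ->
      exists2 B : set (borel 'rV[R]_n), measurable B & Z = dual_proj e @^-1` B.
    by rewrite GE; exact: cylinder_sigmaE.
  pose T := g_sigma_algebraType (cylinder G).
  pose add (x y : T) : T := ((x : U) + (y : U))%R.
  have mproj : measurable_fun [set: T] (dual_proj e : T -> borel 'rV[R]_n).
    by move=> _ C mC; rewrite setTI; exact: cylinder_measurable.
  have translateE (B : set (borel 'rV[R]_n)) (y : T) :
      [set x : T | (dual_proj e @^-1` B) (add x y)] =
      dual_proj e @^-1` [set v : 'rV[R]_n | B (v + dual_proj e y)%R].
    by apply/seteqP; split => u /=; rewrite dual_projD.
  have madd (A : set T) (y : T) : measurable A ->
      measurable [set x : T | A (add x y)].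
    move=> /sigmaE[B mB ->]; rewrite translateE.
    by apply: cylinder_measurable => //; exact: measurable_translate.
  have madd_m1 (A : set T) : measurable A ->
      measurable_fun [set: T] (fun y : T => m1 [set x | A (add x y)] : \bar R).
    move=> /sigmaE[B mB ->].
    have := measurableT_comp (measurable_translate_measure
      (cylindrical_image mu1 e) mB) mproj.
    apply: eq_measurable_fun => y _ /=.
    rewrite translateE -m1E//.
    by apply: cylinder_measurable => //; exact: measurable_translate.
  pose mix := isMeasure.Build _ _ _ (gconvolution add m1 m2)
    (gconvolution0 _ _ _) (@gconvolution_ge0 _ _ _ add m1 m2)
    (gconvolution_sigma_additive madd madd_m1).
  pose m : {measure set T -> \bar R} := HB.pack (gconvolution add m1 m2) mix.
  exists m => Z mZ; have [B mB ZE] := sigmaE _ mZ.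
  rewrite ZE nuE// (convolution_image _ m2E)//.
  apply: eq_integral => y _; apply: m1E; apply: (madd _ y).
  exact: cylinder_measurable.
have nu_setT : nu setT = 1.
  pose a (i : 'I_0) : dual := match i with Ordinal _ i0 => False_rect _ (notF i0) end.
  rewrite -(preimage_setT (dual_proj a)) nuE//.
  exact: (probability_setT (convolution _ _)).
by exists (CylindricalProbability nu_ge0 nu_measure nu_setT).
Qed.

(* The formula determines the convolution on cylinder setT. *)
Definition cylindrical_convolution (mu1 mu2 : cylindrical_probability) :
    cylindrical_probability :=
  sval (cid (cylindrical_convolution_exists mu1 mu2)).

Lemma cylindrical_convolutionE (mu1 mu2 : cylindrical_probability)
    n (a : 'I_n -> dual) (B : set (borel 'rV[R]_n)) : measurable B ->
  cylindrical_convolution mu1 mu2 (dual_proj a @^-1` B) =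
  convolution (cylindrical_image mu1 a) (cylindrical_image mu2 a) B.
Proof.
exact: (svalP (cid (cylindrical_convolution_exists mu1 mu2)) n a B).
Qed.

Definition cylindrical_power (k : nat) (mu : cylindrical_probability) :
    cylindrical_probability :=
  iter k.-1 (fun nu => cylindrical_convolution nu mu) mu.

Definition cylindrical_infinitely_divisible (mu : cylindrical_probability) :=
  forall k, (0 < k)%N -> exists mu_k : cylindrical_probability,
    forall Z, cylinder setT Z -> mu Z = cylindrical_power k mu_k Z.

Definition weakly_infinitely_divisible (mu : cylindrical_probability) :=
  forall n (a : 'I_n -> dual), infinitely_divisible (cylindrical_image mu a).

End cylindrical.

(* Main.v *)
From HB Require Import structures.
Require Import Defs.
From mathcomp Require Import all_boot all_order all_algebra.
From mathcomp Require Import all_classical all_reals all_analysis.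
From mathcomp Require Import measurable_realfun.
From mathcomp Require Import giry complex ring lra.
Import Order.TTheory GRing.Theory Num.Theory numFieldNormedType.Exports.

Set Implicit Arguments.
Unset Strict Implicit.
Unset Printing Implicit Defensive.

Local Open Scope classical_set_scope.
Local Open Scope ring_scope.

(* Characteristic functions determine probability measures on R^n. That of an
   infinitely divisible measure has no zero: a zero at 2t forces
   |phi_k(t)|^2 <= 1/2 for the k-th root, for every k, hence a zero at t, and by
   halving a zero at 0. So the quotient of the characteristic functions of two
   k-th roots is a continuous function with values in the k-th roots of unity,
   equal to 1 at 0, and k-th roots are unique.
   By uniqueness the roots of the finite-dimensional images of a weakly
   infinitely divisible cylindrical measure are consistent, and form its root.

   If mu is Radon with mu(K) > 1 - e for a compact K, then the image of the root
   gives mass > 1 - e to some translate of the image of K. If e is small, the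
   k-fold sumset of this translate meets the image of K, which confines the
   translation to a compact set independent of the finite-dimensional image.
   So the cylindrical root is tight. A tight cylindrical measure is countably
   additive and extends to a Radon measure: Borel sets and sets of the
   sigma-algebra of cylinders have the same traces on a sigma-compact set, since
   countably many norming functionals determine the norm there. *)

(** * Integrals of bounded measurable functions *)

(** Uniqueness of characteristic functions rests on the functions reached from cosines and sines by
    linear combinations and bounded pointwise limits, operations that integrals respect. The
    product-to-sum formulas make this class an algebra, a polynomial iteration puts signs of its
    members into it, and indicators of slabs follow.

    Two obstacles shape the rest. A projection of U to R^n need not be onto, so a cylinder
    determines its base only on a subspace, and a root is not known in advance to live there; bases
    are therefore compared after a matrix projection onto that subspace. In a nonseparable U the
    cylinders may generate fewer sets than the open sets do, and even a compact set may lie outside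
    the generated sigma-algebra. Hence tightness is expressed by cylinders that miss a compact set,
    the outer measure is cut down to a sigma-compact set before the Caratheodory criterion is
    applied, and equality on cylinders is extended to Borel sets for measures carried by
    sigma-compact sets. *)

Section bounded_measurable.
Context d (T : measurableType d) (R : realType).
Implicit Types (f g : T -> R) (mu : probability T R).

Definition bounded_measurable f :=
  measurable_fun setT f /\ exists M : R, forall x, `|f x| <= M.

Lemma bounded_measurable_integrable mu f : bounded_measurable f ->
  mu.-integrable setT (EFin \o f).
Proof.
move=> [mf [M fM]]; apply: measurable_bounded_integrable => //.
  by rewrite (_ : _ setT = 1%E) ?ltry//; exact: probability_setT.
by exists M; split; [exact: num_real|move=> N /ltW MN x _; exact: le_trans MN].
Qed.

Lemma bounded_measurable_cst c : bounded_measurable (cst c).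
Proof. by split; [exact: measurable_cst|exists `|c|]. Qed.

Lemma bounded_measurableD f g : bounded_measurable f -> bounded_measurable g ->
  bounded_measurable (fun x => f x + g x).
Proof.
move=> [mf [M fM]] [mg [N gN]]; split; first exact: measurable_funD.
by exists (M + N) => x; rewrite (le_trans (ler_normD _ _))// lerD.
Qed.

Lemma bounded_measurableM f g : bounded_measurable f -> bounded_measurable g ->
  bounded_measurable (fun x => f x * g x).
Proof.
move=> [mf [M fM]] [mg [N gN]]; split; first exact: measurable_funM.
by exists (M * N) => x; rewrite normrM ler_pM.
Qed.

Lemma bounded_measurableZ c f : bounded_measurable f ->
  bounded_measurable (fun x => c * f x).
Proof. exact: (bounded_measurableM (bounded_measurable_cst c)). Qed.

Lemma RintegralD_bounded mu f g : bounded_measurable f -> bounded_measurable g ->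
  (\int[mu]_x (f x + g x) = \int[mu]_x f x + \int[mu]_x g x)%R.
Proof. by move=> bf bg; rewrite RintegralD//; exact: bounded_measurable_integrable. Qed.

Lemma RintegralZ_bounded mu c f : bounded_measurable f ->
  (\int[mu]_x (c * f x) = c * \int[mu]_x f x)%R.
Proof. by move=> bf; rewrite RintegralZl//; exact: bounded_measurable_integrable. Qed.

Lemma Rintegral_probability_cst mu c : (\int[mu]_x c = c)%R.
Proof.
rewrite Rintegral_cst// [X in fine X](_ : _ = 1%E) ?mulr1//; exact: probability_setT.
Qed.

Lemma EFin_Rintegral_bounded mu f : bounded_measurable f ->
  (\int[mu]_x (f x)%:E = (\int[mu]_x f x)%:E)%E.
Proof.
move=> bf; rewrite /Rintegral fineK//; apply: integrable_fin_num => //.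
exact: bounded_measurable_integrable.
Qed.

(** Dominated convergence with the constant M as dominating function. It handles the limit case in
    inductions over [trig_closure] and gives the continuity of characteristic functions along
    lines. *)
Lemma bounded_measurable_approx mu f (f_ : nat -> T -> R) M :
  (forall n, measurable_fun setT (f_ n)) -> (forall n x, `|f_ n x| <= M) ->
  (forall x, f_ ^~ x @ \oo --> f x) ->
  bounded_measurable f /\
  ((fun n => \int[mu]_x f_ n x) @ \oo --> \int[mu]_x f x)%R.
Proof.
move=> mf_ fM f_f.
have mf : measurable_fun setT f.
  by apply: (measurable_fun_cvg (h := f_)).
have bf : bounded_measurable f.
  split=> //; exists M => x; move: (f_f x) => /cvg_norm.
  by move=> /cvgr_to_le; apply; exact: nearW.
split=> //; apply: fine_cvg; rewrite -EFin_Rintegral_bounded//.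
apply: (@dominated_cvg _ _ _ mu _ _ (fun n x => (f_ n x)%:E) _ (cst M%:E)) => //.
- by move=> n; exact/measurable_EFinP.
- by move=> x _; apply: cvg_EFin; [apply: nearW|exact: f_f].
- exact: (bounded_measurable_integrable mu (bounded_measurable_cst M)).
- by move=> n x _; rewrite lee_fin.
Qed.

End bounded_measurable.
Arguments bounded_measurable_cst {d T R} c.

Lemma bounded_measurable_comp d d' (T : measurableType d) (T' : measurableType d')
    (R : realType) (f : T' -> R) (g : T -> T') :
  bounded_measurable f -> measurable_fun setT g -> bounded_measurable (f \o g).
Proof.
move=> [mf [M fM]] mg; split; first exact: measurableT_comp.
by exists M => x; exact: fM.
Qed.

(** * Integration against a convolution *)

Section convolution_integral.
Context (R : realType) (V : normedModType R).
Variables mu1 mu2 : probability (borel V) R.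

Let shift (y : V) : borel V -> borel V := fun x => (x : V) + y.

Let measurable_shift y : measurable_fun [set: borel V] (shift y).
Proof. by move=> _ A mA; rewrite setTI; exact: measurable_translate. Qed.

(** The law of x + y for x distributed by [mu1]. The convolution is the Giry bind of [mu2] with this
    kernel, so its integration formula comes from [giry_int_bind] and involves no product
    measure. *)
Let kernel (y : borel V) : giry (borel V) R :=
  giry_map (measurable_shift y) (mu1 : subprobability _ R).

Let measurable_kernel : measurable_fun [set: borel V] kernel.
Proof.
apply: measurable_giry_codensity => // B mB.
exact: measurable_translate_measure.
Qed.

Lemma ge0_integral_convolution (f : V -> \bar R) :
  measurable_fun [set: borel V] f -> (forall x, 0 <= f x)%E ->
  (\int[convolution mu1 mu2]_z f z =
   \int[mu2]_y \int[mu1]_x f (x + y)%R)%E.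
Proof.
move=> mf f0.
transitivity (giry_int (giry_bind (mu2 : subprobability _ R) measurable_kernel) f).
  rewrite /giry_int; apply: eq_measure_integral => A mA _.
  rewrite /giry_bind/= /giry_int ge0_integral_pushforward//.
  exact: measurable_giry_ev.
rewrite giry_int_bind//; apply: eq_integral => y _.
by rewrite /kernel giry_int_map.
Qed.

Lemma bounded_measurable_shift (f : V -> R) (y : V) :
  bounded_measurable (f : borel V -> R) ->
  bounded_measurable ((fun x => f (x + y)) : borel V -> R).
Proof. by move=> bf; exact: (bounded_measurable_comp bf (measurable_shift y)). Qed.

Lemma bounded_measurable_Rintegral_shift (f : V -> R) :
  bounded_measurable (f : borel V -> R) ->
  bounded_measurable ((fun y => \int[mu1]_x f (x + y))%R : borel V -> R).
Proof.
move=> bf; have [mf [M fM]] := bf.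
(* Adding the bound M makes the integrand nonnegative, as the integration formulas in the extended
   reals require; M is subtracted again at the end. *)
have bfM := bounded_measurableD bf (bounded_measurable_cst M).
have fM0 x : (0 <= (f x + M)%:E)%E.
  by rewrite lee_fin -lerBlDr sub0r; have := fM x; rewrite ler_norml => /andP[].
have -> : (fun y : V => \int[mu1]_x f (x + y))%R =
    (fun y => \int[mu1]_x (f (x + y) + M) - M)%R.
  apply/funext => y; rewrite RintegralD_bounded.
  - by rewrite Rintegral_probability_cst addrK.
  - exact: bounded_measurable_shift.
  - exact: bounded_measurable_cst.
split.
  apply: measurable_funB; last exact: measurable_cst.
  apply/measurable_EFinP.
  have -> : EFin \o (fun y : V => \int[mu1]_x (f (x + y) + M))%R =
      (fun nu : giry (borel V) R =>
        giry_int nu (fun x : borel V => (f x + M)%:E)) \o kernel.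
    apply/funext => y /=; rewrite /kernel giry_int_map//.
      by rewrite -EFin_Rintegral_bounded//; exact: (bounded_measurable_shift y bfM).
    by apply/measurable_EFinP; exact: bfM.1.
  apply: (@measurableT_comp _ _ _ (borel V) (giry (borel V) R) (\bar R)) => //.
  apply: measurable_giry_int => //.
  by apply/measurable_EFinP; exact: bfM.1.
exists M => y; rewrite RintegralD_bounded; last 2 first.
- exact: bounded_measurable_shift.
- exact: bounded_measurable_cst.
rewrite Rintegral_probability_cst addrK.
have bfy := bounded_measurable_shift y bf.
apply: le_trans (le_normr_Rintegral _ (bounded_measurable_integrable mu1 bfy)) _ => //.
rewrite -[leRHS](Rintegral_probability_cst mu1); apply: le_Rintegral => //.
- apply: bounded_measurable_integrable; have [mfy [N fN]] := bfy.
  by split; [exact: measurableT_comp|exists N => x; rewrite normr_id].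
- exact: (bounded_measurable_integrable mu1 (bounded_measurable_cst M)).
Qed.

Lemma Rintegral_convolution (f : V -> R) :
  bounded_measurable (f : borel V -> R) ->
  (\int[convolution mu1 mu2]_z f z =
   \int[mu2]_y \int[mu1]_x f (x + y)%R)%R.
Proof.
move=> bf; have [mf [M fM]] := bf.
have bfM := bounded_measurableD bf (bounded_measurable_cst M).
have fM0 x : (0 <= (f x + M)%:E)%E.
  by rewrite lee_fin -lerBlDr sub0r; have := fM x; rewrite ler_norml => /andP[].
have /(f_equal fine) : (\int[convolution mu1 mu2]_z (f z + M)%:E =
    \int[mu2]_y \int[mu1]_x (f (x + y)%R + M)%:E)%E.
  apply: ge0_integral_convolution; last by [].
  by apply/measurable_EFinP; exact: bfM.1.
rewrite EFin_Rintegral_bounded//=.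
under [in X in _ = X -> _]eq_integral => y _.
  rewrite EFin_Rintegral_bounded; last exact: (bounded_measurable_shift y bfM).
  over.
rewrite EFin_Rintegral_bounded/=; last exact: (bounded_measurable_Rintegral_shift bfM).
rewrite RintegralD_bounded//; last exact: bounded_measurable_cst.
under [in X in _ = X -> _]eq_Rintegral => y _.
  rewrite RintegralD_bounded; last 2 first.
  - exact: bounded_measurable_shift.
  - exact: bounded_measurable_cst.
  over.
rewrite RintegralD_bounded; last 2 first.
- exact: bounded_measurable_Rintegral_shift.
- exact: bounded_measurable_cst.
by rewrite !Rintegral_probability_cst => /addIr.
Qed.

End convolution_integral.

(** * Uniqueness of characteristic functions *)

Section trigonometric_closure.
Context d (T : measurableType d) (R : realType).
Variable L : set (T -> R).
Hypothesis L0 : L (cst 0).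
Hypothesis LD : forall l m, L l -> L m -> L (fun x => l x + m x).
Hypothesis LZ : forall c l, L l -> L (fun x => c * l x).
Hypothesis mL : forall l, L l -> measurable_fun setT l.

(** The constructors are operations under which equality of two integrals persists. Products, signs
    and indicators are derived and not built in, since integrals are not multiplicative. *)
Inductive trig_closure : (T -> R) -> Prop :=
| trig_cos l : L l -> trig_closure (fun x => cos (l x))
| trig_sin l : L l -> trig_closure (fun x => sin (l x))
| trigD f g : trig_closure f -> trig_closure g ->
    trig_closure (fun x => f x + g x)
| trigZ c f : trig_closure f -> trig_closure (fun x => c * f x)
| trig_lim (f_ : nat -> T -> R) f M : (forall n, trig_closure (f_ n)) ->
    (forall n x, `|f_ n x| <= M) -> (forall x, f_ ^~ x @ \oo --> f x) ->
    trig_closure f.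

Lemma eq_trig f g : f =1 g -> trig_closure f -> trig_closure g.
Proof. by move=> /funext ->. Qed.

Let LB l m : L l -> L m -> L (fun x => l x - m x).
Proof.
move=> Ll Lm; have -> : (fun x => l x - m x) = (fun x => l x + (-1) * m x).
  by apply/funext => x; rewrite mulN1r.
by apply: LD => //; exact: LZ.
Qed.

Lemma bounded_measurable_cos (l : T -> R) : measurable_fun setT l ->
  bounded_measurable (fun x => cos (l x)).
Proof.
move=> ml; split; last by exists 1 => x; rewrite ler_norml cos_geN1 cos_le1.
by apply: measurableT_comp ml; apply: continuous_measurable_fun; exact: continuous_cos.
Qed.

Lemma bounded_measurable_sin (l : T -> R) : measurable_fun setT l ->
  bounded_measurable (fun x => sin (l x)).
Proof.
move=> ml; split; last by exists 1 => x; rewrite ler_norml sin_geN1 sin_le1.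
by apply: measurableT_comp ml; apply: continuous_measurable_fun; exact: continuous_sin.
Qed.

Lemma bounded_measurable_trig (mu : probability T R) f :
  trig_closure f -> bounded_measurable f.
Proof.
elim=> {f} [l Ll|l Ll|f g _ bf _ bg|c f _ bf|f_ f M _ bf_ fM f_f].
- by apply: bounded_measurable_cos; exact: mL.
- by apply: bounded_measurable_sin; exact: mL.
- exact: bounded_measurableD.
- exact: bounded_measurableZ.
- by have [] := bounded_measurable_approx mu (fun n => (bf_ n).1) fM f_f.
Qed.

Lemma trig_Rintegral (mu nu : probability T R) :
  (forall l, L l -> \int[mu]_x cos (l x) = \int[nu]_x cos (l x))%R ->
  (forall l, L l -> \int[mu]_x sin (l x) = \int[nu]_x sin (l x))%R ->
  forall f, trig_closure f -> (\int[mu]_x f x = \int[nu]_x f x)%R.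
Proof.
move=> hcos hsin f.
elim=> {f} [l Ll|l Ll|f g tf hf tg hg|c f tf hf|f_ f M tf_ hf_ fM f_f].
- exact: hcos.
- exact: hsin.
- by rewrite !RintegralD_bounded ?hf ?hg//; exact: (bounded_measurable_trig mu).
- by rewrite !RintegralZ_bounded ?hf//; exact: (bounded_measurable_trig mu).
- have mf_ n : measurable_fun setT (f_ n).
    by have [] := bounded_measurable_trig mu (tf_ n).
  have [_ cmu] := bounded_measurable_approx mu mf_ fM f_f.
  have [_ cnu] := bounded_measurable_approx nu mf_ fM f_f.
  have e : (fun n => \int[mu]_x f_ n x)%R = (fun n => \int[nu]_x f_ n x)%R.
    by apply/funext => n; exact: hf_.
  by rewrite e in cmu; exact: cvg_unique cmu cnu.
Qed.

Lemma trig_cst c : trig_closure (cst c).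
Proof.
apply: (eq_trig (f := fun x => c * cos (cst 0 x))).
  by move=> x; rewrite /= cos0 mulr1.
by apply: trigZ; exact: trig_cos.
Qed.

Let trig_bounded f : trig_closure f -> exists M, forall x, `|f x| <= M.
Proof.
elim=> {f} [l Ll|l Ll|f g _ [M fM] _ [N gN]|c f _ [M fM]|f_ f M _ _ fM f_f].
- by exists 1 => x; rewrite ler_norml cos_geN1 cos_le1.
- by exists 1 => x; rewrite ler_norml sin_geN1 sin_le1.
- by exists (M + N) => x; rewrite (le_trans (ler_normD _ _))// lerD.
- by exists (`|c| * M) => x; rewrite normrM ler_wpM2l.
- exists M => x; move: (f_f x) => /cvg_norm.
  by move=> /cvgr_to_le; apply; exact: nearW.
Qed.

(** Multiplication by a fixed bounded g is linear and preserves bounded limits, so only the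
    generators need checking. [trigM] uses this twice, the second time with a generator as
    multiplier, which leaves the product-to-sum formulas. *)
Let trigM_gen g : (forall l, L l -> trig_closure (fun x => cos (l x) * g x)) ->
  (forall l, L l -> trig_closure (fun x => sin (l x) * g x)) ->
  (exists M, forall x, `|g x| <= M) ->
  forall f, trig_closure f -> trig_closure (fun x => f x * g x).
Proof.
move=> gcos gsin [N gN] f.
elim=> {f} [l Ll|l Ll|f1 f2 _ h1 _ h2|c f _ hf|f_ f M _ hf_ fM f_f].
- exact: gcos.
- exact: gsin.
- apply: eq_trig (trigD h1 h2) => x.
  by rewrite mulrDl.
- apply: eq_trig (trigZ c hf) => x.
  by rewrite mulrA.
- apply: (trig_lim (f_ := fun n x => f_ n x * g x) (M := M * N)) => //.
    by move=> n x; rewrite normrM ler_pM.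
  by move=> x; apply: cvgMl; exact: f_f.
Qed.

Lemma trigM f g : trig_closure f -> trig_closure g ->
  trig_closure (fun x => f x * g x).
Proof.
have cc l m : L l -> L m -> trig_closure (fun x => cos (l x) * cos (m x)).
  move=> Ll Lm; have := trigZ 2^-1 (trigD (trig_cos (LD Ll Lm)) (trig_cos (LB Ll Lm))).
  by apply: eq_trig => x /=; rewrite cosB cosD; field.
have ss l m : L l -> L m -> trig_closure (fun x => sin (l x) * sin (m x)).
  move=> Ll Lm; have := trigD (trigZ 2^-1 (trig_cos (LB Ll Lm)))
    (trigZ (- 2^-1) (trig_cos (LD Ll Lm))).
  by apply: eq_trig => x /=; rewrite cosB cosD; field.
have sc l m : L l -> L m -> trig_closure (fun x => sin (l x) * cos (m x)).
  move=> Ll Lm; have := trigZ 2^-1 (trigD (trig_sin (LD Ll Lm)) (trig_sin (LB Ll Lm))).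
  by apply: eq_trig => x /=; rewrite sinB sinD; field.
move=> tf tg; apply: trigM_gen tf; last exact: trig_bounded.
- move=> l Ll; apply: (eq_trig (f := fun x => g x * cos (l x))).
    by move=> x; rewrite mulrC.
  apply: trigM_gen tg.
  + by move=> m Lm; exact: cc.
  + by move=> m Lm; exact: sc.
  + by apply: trig_bounded; exact: trig_cos.
- move=> l Ll; apply: (eq_trig (f := fun x => g x * sin (l x))).
    by move=> x; rewrite mulrC.
  apply: trigM_gen tg.
  + by move=> m Lm; apply: eq_trig (sc _ _ Ll Lm) => x; rewrite mulrC.
  + by move=> m Lm; exact: ss.
  + by apply: trig_bounded; exact: trig_sin.
Qed.

(* Iterating this map converges to the sign of y, for |y| <= 1. *)
Let sgn_step (y : R) := y * (3 - y ^+ 2) / 2.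

Let sgn_step_cvg (y : R) : `|y| <= 1 ->
  (forall n, `|iter n sgn_step y| <= 1) /\
  ((fun n => iter n sgn_step y) @ \oo --> Num.sg y).
Proof.
have pos z : 0 < z <= 1 -> forall n,
    z <= iter n sgn_step z <= 1 /\ 1 - iter n sgn_step z <= (1 - z / 2) ^+ n.
  move=> /andP[z0 z1]; elim=> [|n] /=.
    by rewrite lexx z1 expr0; split=> //; lra.
  set w := iter n _ _ => -[/andP[zw w1] hw]; rewrite /sgn_step.
  have w0 : 0 <= w by rewrite (le_trans (ltW z0)).
  have w10 : 0 <= 1 - w by rewrite subr_ge0.
  (* With w' the image of w under [sgn_step], the products in [h1], [h2], [h3] are 2 (w' - w), 2 (1
     - w') and 2 ((1 - z/2) (1 - w) - (1 - w')). They give monotonicity, the upper bound 1 and the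
     contraction by 1 - z/2. *)
  have h1 : 0 <= w * ((1 - w) * (1 + w)) by rewrite !mulr_ge0// addr_ge0.
  have h2 : 0 <= (1 - w) * (1 - w) * (w + 2) by rewrite !mulr_ge0// addr_ge0.
  have h3 : 0 <= (1 - w) * (w ^+ 2 + (w - z)).
    by rewrite mulr_ge0// addr_ge0 ?sqr_ge0// subr_ge0.
  split; first by apply/andP; split; nra.
  apply: (@le_trans _ _ ((1 - z / 2) * (1 - w))); first by nra.
  by rewrite exprS ler_wpM2l//; lra.
have odd z n : iter n sgn_step (- z) = - iter n sgn_step z.
  elim: n => //= n ->; rewrite /sgn_step sqrrN.
  by field.
have posc z : 0 < z <= 1 -> (fun n => iter n sgn_step z) @ \oo --> (1 : R).
  move=> z01; have /andP[z0 z1] := z01.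
  have c0 : (fun n => 1 - (1 - z / 2) ^+ n) @ \oo --> (1 : R).
    rewrite -[X in _ --> X]subr0; apply: cvgB; first exact: cvg_cst.
    by apply: cvg_expr; rewrite ger0_norm; lra.
  apply: (@squeeze_cvgr _ \oo _ R (fun n => 1 - (1 - z / 2) ^+ n) (cst 1) _ _ 1 c0);
    last exact: cvg_cst.
  apply: nearW => n.
  by have [/andP[_ ->]] := pos z z01 n; rewrite andbT; lra.
move=> y1.
have [y0|y0|y0] := ltgtP 0 y.
- have y01 : 0 < y <= 1 by rewrite y0/=; move: y1; rewrite ger0_norm// ltW.
  split; last by rewrite gtr0_sg//; exact: posc.
  by move=> n; have [/andP[h1 h2] _] := pos y y01 n; rewrite ger0_norm// (le_trans _ h1)// ltW.
- have y01 : 0 < - y <= 1 by rewrite oppr_gt0 y0/=; move: y1; rewrite ltr0_norm.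
  split.
    move=> n; rewrite -normrN -odd; have [/andP[h1 h2] _] := pos _ y01 n.
    by rewrite ger0_norm// (le_trans _ h1)// ltW// oppr_gt0.
  rewrite ltr0_sg// -[y]opprK; under eq_fun do rewrite odd.
  by apply: cvgN; exact: posc.
- have it0 n : iter n sgn_step 0 = 0.
    by elim: n => //= n ->; rewrite /sgn_step !mul0r.
  rewrite -y0; split; first by move=> n; rewrite it0 normr0.
  by under eq_fun do rewrite it0; rewrite sgr0; exact: cvg_cst.
Qed.

Lemma trig_sg f : trig_closure f -> trig_closure (fun x => Num.sg (f x)).
Proof.
move=> tf; have [M fM] := trig_bounded tf.
(* Division by this number brings f into [-1, 1], where the iteration converges, without changing
   its sign; the added 1 keeps the divisor positive. *)
have M0 : 0 < `|M| + 1 by rewrite ltr_wpDl.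
pose g x := (`|M| + 1)^-1 * f x.
have g1 x : `|g x| <= 1.
  rewrite normrM ger0_norm ?invr_ge0 ?(ltW M0)// mulrC ler_pdivrMr// mul1r.
  by rewrite (le_trans (fM x))// (le_trans (ler_norm _))// lerDl.
apply: (eq_trig (f := fun x => Num.sg (g x))).
  by move=> x; rewrite sgrM gtr0_sg ?mul1r// invr_gt0.
apply: (trig_lim (f_ := fun n x => iter n sgn_step (g x)) (M := 1)).
- elim=> [|n ih] /=; first exact: trigZ.
  apply: (eq_trig (f := fun x => iter n sgn_step (g x) *
     (2^-1 * (3 + (-1) * (iter n sgn_step (g x) * iter n sgn_step (g x)))))).
    by move=> x; rewrite /sgn_step; field.
  apply: trigM => //; apply: trigZ; apply: trigD; first exact: trig_cst.
  by apply: trigZ; exact: trigM.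
- by move=> n x; have [] := sgn_step_cvg (g1 x).
- by move=> x; have [] := sgn_step_cvg (g1 x).
Qed.

(** With s the sign of f, the indicator is (s + s^2) / 2. *)
Lemma trig_indic_gt0 f : trig_closure f -> trig_closure \1_[set x | 0 < f x].
Proof.
move=> /trig_sg tf.
have := trigZ 2^-1 (trigD tf (trigM tf tf)).
apply: eq_trig => x; rewrite indicE.
have [fx|fx|fx] := ltgtP 0 (f x).
- by rewrite gtr0_sg// mem_set//=; field.
- by rewrite ltr0_sg// memNset/=; [field|rewrite /= ltNge ltW].
- by rewrite -fx sgr0 memNset/=; [field|rewrite /= -fx ltxx].
Qed.

Lemma trig_indicI A B : trig_closure \1_A -> trig_closure \1_B ->
  trig_closure \1_(A `&` B).
Proof.
by move=> tA tB; apply: eq_trig (trigM tA tB) => x; rewrite indicI.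
Qed.

Lemma trig_indic_itv l c r : L l -> trig_closure \1_[set x | `|l x - c| < r].
Proof.
move=> Ll; have [r0|r0] := leP r 0.
  apply: (eq_trig _ (trig_cst 0)) => x; rewrite indicE memNset//=.
  by apply/negP; rewrite -leNgt (le_trans r0).
(* For n large, |l x - c| < r iff cos (s n * (l x - c)) > cos (s n * r). *)
pose s (n : nat) : R := n.+1%:R^-1.
pose A (n : nat) := [set x | 0 < cos (s n * (l x - c)) - cos (s n * r)].
have tA n : trig_closure \1_(A n).
  apply: trig_indic_gt0; apply: trigD; last exact: trig_cst.
  have Ls : L (fun x => s n * l x) by exact: LZ.
  have := trigD (trigZ (cos (s n * c)) (trig_cos Ls)) (trigZ (sin (s n * c)) (trig_sin Ls)).
  by apply: eq_trig => x; rewrite mulrBr cosB; ring.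
apply: (trig_lim (f_ := fun n => \1_(A n)) (M := 1)) => //.
  by move=> n x; rewrite indicE; case: (_ \in _); rewrite ?normr1 ?normr0.
move=> x; apply: cvg_near_cst.
(* From N on, the rescaled distances lie in [0, pi], where cos decreases, so membership in [A n] is
   the right condition. N depends on x: the indicators converge pointwise, by being eventually
   constant. *)
have [N hN] : exists N : nat, `|l x - c| + r <= N%:R * pi.
  exists (Num.truncn ((`|l x - c| + r) / pi)).+1.
  by rewrite -ler_pdivrMr ?pi_gt0//; apply/ltW/truncnS_gt.
exists N => // n /= Nn; rewrite !indicE; congr (_%:R); congr nat_of_bool.
have s0 : 0 < s n by rewrite invr_gt0.
have sN y : 0 <= y <= `|l x - c| + r -> s n * y \in `[0, pi].
  move=> /andP[y0 yN]; rewrite in_itv/= mulr_ge0 ?(ltW s0)//= /s mulrC.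
  rewrite ler_pdivrMr// mulrC (le_trans yN)// (le_trans hN)//.
  by rewrite ler_wpM2r ?pi_ge0// ler_nat ltnW.
apply/idP/idP; rewrite !inE /A /= subr_gt0 -[cos (_ * (_ - _))]cos_norm normrM (gtr0_norm s0).
  by rewrite ltr_cos ?ltr_pM2l// sN// ?normr_ge0 ?lerDl ?lerDr ?(ltW r0)//=.
by rewrite ltr_cos ?ltr_pM2l// sN// ?normr_ge0 ?lerDl ?lerDr ?(ltW r0)//=.
Qed.

(** As the closure is stable under products, the sets whose indicator it contains form a pi-system.
    Both measures agree on it, hence on the sigma-algebra it generates. *)
Lemma probability_unique_trig (G : set (set T)) (mu nu : probability T R) :
  (forall l, L l -> \int[mu]_x cos (l x) = \int[nu]_x cos (l x))%R ->
  (forall l, L l -> \int[mu]_x sin (l x) = \int[nu]_x sin (l x))%R ->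
  (forall A, G A -> trig_closure \1_A) ->
  forall A, <<s G >> A -> mu A = nu A.
Proof.
move=> hcos hsin tG.
pose H : set (set T) := [set A | trig_closure \1_A].
suff HE A : <<s H >> A -> mu A = nu A.
  by move=> A GA; apply: HE; move: A GA; exact: sub_smallest2r.
have mH B : H B -> measurable B.
  move=> /(bounded_measurable_trig mu)[mB _].
  have -> : B = \1_B @^-1` [set (1 : R)].
    apply/seteqP; split => x /=; rewrite indicE; first by move=> /mem_set ->.
    by case: (boolP (x \in B)) => [/set_mem//|_ /eqP]; rewrite eq_sym oner_eq0.
  by rewrite -[X in measurable X]setTI; apply: mB.
have HT : H setT.
  by apply: eq_trig (trig_cst 1) => x; rewrite indicT.
apply: (g_sigma_algebra_measure_unique H mH (fun=> setT)) => //.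
- by rewrite bigcup_const.
- by move=> B C; exact: trig_indicI.
- move=> B HB; have := trig_Rintegral hcos hsin HB.
  rewrite /Rintegral !integral_indic ?setIT//; try exact: mH.
  move=> e; rewrite -[LHS]fineK; last exact: fin_num_measure (mH _ HB).
  rewrite -[RHS]fineK; last exact: fin_num_measure (mH _ HB).
  by congr (_%:E).
- by move=> _; rewrite [ltLHS](_ : _ = 1%E) ?ltry//; exact: probability_setT.
Qed.

End trigonometric_closure.

(** * Probability measures on R^n *)

Section dot_product.
Context (R : realType) (n : nat).

Definition dot (t x : 'rV[R]_n) : R := \sum_i t ord0 i * x ord0 i.

Lemma dotD t x y : dot t (x + y) = dot t x + dot t y.
Proof. by rewrite -big_split; apply: eq_bigr => i _; rewrite mxE mulrDr. Qed.

Lemma continuous_dot t : continuous (dot t).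
Proof.
apply: continuous_big => [|i _]; first exact: add_continuous.
move=> x; apply: (@continuousM R 'rV[R]_n (cst (t ord0 i)) (fun x => x ord0 i)).
  exact: cst_continuous.
exact: coord_continuous.
Qed.

Lemma measurable_continuous_borel (V : ptopologicalType) (f : V -> R) :
  continuous f -> measurable_fun [set: borel V] f.
Proof.
move=> /continuousP cf; apply: (measurability _ (RGenOpens.measurableE R)).
move=> _ [_ [a [b ->]] <-]; rewrite setTI; apply: sub_sigma_algebra.
by apply: cf; exact: interval_open.
Qed.


Lemma dotDl s t x : dot (s + t) x = dot s x + dot t x.
Proof. by rewrite -big_split; apply: eq_bigr => i _; rewrite mxE mulrDl. Qed.

Lemma dotZl c t x : dot (c *: t) x = c * dot t x.
Proof. by rewrite mulr_sumr; apply: eq_bigr => i _; rewrite mxE mulrA. Qed.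

Lemma dot_delta i x : dot (delta_mx ord0 i) x = x ord0 i.
Proof.
rewrite /dot (bigD1 i)//= mxE !eqxx mul1r big1 ?addr0// => j ji.
by rewrite mxE (negbTE ji) andbF mul0r.
Qed.

Let rat_ball (q : 'rV[rat]_n * nat) : set 'rV[R]_n :=
  ball (map_mx ratr q.1 : 'rV[R]_n) q.2.+1%:R^-1.

(** An open set is the union of the countably many balls inside it that have a rational centre and a
    radius 1/(m+1); a ball not inside it is replaced by [set0]. *)
Lemma open_rV_sigma_balls (A : set 'rV[R]_n) : open A ->
  <<s [set ball c r | c in [set: 'rV[R]_n] & r in [set: R]] >> A.
Proof.
move=> oA; set G := [set _ | _ in _ & _ in _].
have -> : A = \bigcup_q (if `[< rat_ball q `<=` A >] then rat_ball q else set0).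
  apply/seteqP; split => [x Ax|x [q _]]; last first.
    by case: asboolP => [qA|_]; [exact: qA|].
  have /nbhs_ballP[e /= e0 eA] : nbhs x A by exact: open_nbhs_nbhs.
  (* A small ball containing x has diameter at most twice its radius, which has to be below e. *)
  pose m := Num.truncn (2 / e).
  have me : 2 * m.+1%:R^-1 < e.
    by rewrite -ltr_pdivlMr ?invr_gt0// invrK mulrC -ltr_pdivrMr// truncnS_gt.
  have /choice[q qP] : forall i, exists q : rat,
      `|x ord0 i - ratr q| < m.+1%:R^-1.
    move=> i; have : x ord0 i - m.+1%:R^-1 < x ord0 i + m.+1%:R^-1.
      by rewrite ltrBlDr -addrA ltrDl addr_gt0.
    move=> /rat_in_itvoo[q]; rewrite in_itv/= => xq; exists q.
    by rewrite ltr_distlC.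
  have xq : rat_ball (\row_i q i, m) x.
    split; first by rewrite /= invr_gt0.
    by move=> i j; rewrite !mxE -ball_normE/= !ord1 distrC; exact: qP.
  exists (\row_i q i, m) => //; rewrite asboolT// => y qy; apply: eA.
  apply: le_ball (ball_triangle (ball_sym xq) qy).
  by rewrite /= -mulr2n -[leLHS]mulr_natl ltW.
apply: (@countable_bigcupT_measurable _ (g_sigma_algebraType G) _ _ (countableP _)).
move=> q; case: ifPn => _ //; apply: sub_sigma_algebra.
by exists (map_mx ratr q.1 : 'rV[R]_n) => //; exists q.2.+1%:R^-1.
Qed.

Lemma probability_rV_unique (mu nu : probability (borel 'rV[R]_n) R) :
  (forall t, \int[mu]_x cos (dot t x) = \int[nu]_x cos (dot t x))%R ->
  (forall t, \int[mu]_x sin (dot t x) = \int[nu]_x sin (dot t x))%R ->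
  forall A, measurable A -> mu A = nu A.
Proof.
move=> hcos hsin A mA.
pose G := [set ball c r | c in [set: 'rV[R]_n] & r in [set: R]].
pose L := range (fun t x => dot t x).
have L0 : L (cst 0).
  by exists 0 => //; apply/funext => x; rewrite /dot big1// => i _; rewrite mxE mul0r.
have LD l m : L l -> L m -> L (fun x => l x + m x).
  move=> [s _ <-] [t _ <-]; exists (s + t) => //.
  by apply/funext => x; rewrite dotDl.
have LZ c l : L l -> L (fun x => c * l x).
  by move=> [s _ <-]; exists (c *: s) => //; apply/funext => x; rewrite dotZl.
have mL (l : borel 'rV[R]_n -> R) : L l -> measurable_fun setT l.
  by move=> [t _ <-]; apply: measurable_continuous_borel; exact: continuous_dot.
apply: (@probability_unique_trig _ (borel 'rV[R]_n) R L L0 LD LZ mL G mu nu).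
- by move=> _ [t _ <-].
- by move=> _ [t _ <-].
(* For positive r a ball of the maximum norm is a finite intersection of coordinate slabs.
   Nonpositive r is treated apart: for n = 0 the intersection would be everything, but the ball is
   empty. *)
- move=> _ [c _ [r _ <-]]; have [r0|r0] := leP r 0.
    apply: (eq_trig _ (trig_cst L0 0)) => x; rewrite indicE memNset// => -[].
    by rewrite ltNge r0.
  have -> : ball c r = \big[setI/setT]_(j < n) [set x | `|x ord0 j - c ord0 j| < r].
    rewrite -bigcap_seq; apply/seteqP; split => x /=.
      by move=> [_ cx] j _ /=; rewrite distrC; have := cx ord0 j; rewrite -ball_normE.
    move=> cx; split => // i j; rewrite !ord1 -ball_normE/= distrC.
    by apply: (cx j); rewrite /= mem_index_enum.
  elim/big_ind : _ => [|B C|j _].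
  + by apply: eq_trig (trig_cst L0 1) => x; rewrite indicT.
  + exact: trig_indicI.
  + apply: (@trig_indic_itv _ (borel 'rV[R]_n) R L L0 LD LZ (fun x => x ord0 j)).
    by exists (delta_mx ord0 j) => //; apply/funext => x; rewrite dot_delta.
- move: A mA; apply: smallest_sub; first exact: smallest_sigma_algebra.
  exact: open_rV_sigma_balls.
Qed.

End dot_product.

(** * Characteristic functions of infinitely divisible measures *)

Local Open Scope complex_scope.

(** If w is not 1, the powers w^j for j < k sum to 0, so the differences w^j - 1 sum to -k. Each of
    them has modulus at most j |w - 1|, hence at most k |w - 1|. *)
Lemma unity_root_gap (F : numFieldType) (k : nat) (w : F) :
  (0 < k)%N -> w ^+ k = 1 -> w != 1 -> 1 <= k%:R * `|w - 1|.
Proof.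
case: k => // k _ wk w1.
have nw : `|w| = 1.
  by apply/eqP; rewrite -(pexpr_eq1 (n := k.+1))// -normrX wk normr1.
have pw j : `|w ^+ j - 1| <= j%:R * `|w - 1|.
  elim: j => [|j ih]; first by rewrite expr0 subrr normr0 mul0r.
  rewrite (_ : _ - 1 = w * (w ^+ j - 1) + (w - 1)); last by rewrite exprS; ring.
  by rewrite (le_trans (ler_normD _ _))// normrM nw mul1r mulrS mulrDl mul1r addrC lerD2l.
have sum0 : \sum_(j < k.+1) w ^+ j = 0.
  have /eqP := subrX1 w k.+1; rewrite wk subrr eq_sym mulf_eq0 subr_eq0 (negbTE w1)/=.
  by move=> /eqP.
have : `|\sum_(j < k.+1) (w ^+ j - 1)| <= k.+1%:R * (k.+1%:R * `|w - 1|).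
  rewrite (le_trans (ler_norm_sum _ _ _))//.
  apply: (@le_trans _ _ (\sum_(j < k.+1) k.+1%:R * `|w - 1|)).
    by apply: ler_sum => j _; rewrite (le_trans (pw j))// ler_wpM2r// ler_nat ltnW.
  by rewrite sumr_const card_ord -[leLHS]mulr_natl.
rewrite sumrB sum0 sub0r sumr_const card_ord normrN normr_nat.
by rewrite -[leLHS]mulr1 ler_pM2l// ltr0n.
Qed.

Section charfun.
Context d (T : measurableType d) (R : realType).
Implicit Types (mu nu : probability T R) (l : T -> R).

(** The integral of exp(i l). The usual characteristic function at t is the value at [dot t]; a
    function l as argument makes rescaling and other spaces available. *)
Definition charfun mu l : R[i] :=
  (\int[mu]_x cos (l x))%R +i* (\int[mu]_x sin (l x))%R.

Lemma charfun0 mu : charfun mu (cst 0) = 1.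
Proof.
rewrite /charfun.
under eq_Rintegral do rewrite cos0.
under [X in _ +i* X]eq_Rintegral do rewrite sin0.
by rewrite !Rintegral_probability_cst.
Qed.

Lemma eq_charfun mu nu l : (forall A, measurable A -> mu A = nu A) ->
  charfun mu l = charfun nu l.
Proof.
move=> h; rewrite /charfun /Rintegral; congr (fine _ +i* fine _);
  by apply: eq_measure_integral => A mA _; exact: h.
Qed.

Lemma cvg_charfun mu l (s : nat -> R) (a : R) : measurable_fun setT l ->
  s @ \oo --> a ->
  ((fun n => complex.Re (charfun mu (fun x => s n * l x))) @ \oo -->
    complex.Re (charfun mu (fun x => a * l x))) /\
  ((fun n => complex.Im (charfun mu (fun x => s n * l x))) @ \oo -->
    complex.Im (charfun mu (fun x => a * l x))).
Proof.
move=> ml sa.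
have slx x : (fun n => s n * l x) @ \oo --> a * l x by exact: cvgMl.
split => /=.
  refine (bounded_measurable_approx mu (f_ := fun n x => cos (s n * l x)) (M := 1) _ _ _).2.
  - move=> n; apply: (bounded_measurable_cos _).1; exact: measurable_funM.
  - by move=> n x; rewrite ler_norml cos_geN1 cos_le1.
  - by move=> x; apply: continuous_cvg (slx x); exact: continuous_cos.
refine (bounded_measurable_approx mu (f_ := fun n x => sin (s n * l x)) (M := 1) _ _ _).2.
- move=> n; apply: (bounded_measurable_sin _).1; exact: measurable_funM.
- by move=> n x; rewrite ler_norml sin_geN1 sin_le1.
- by move=> x; apply: continuous_cvg (slx x); exact: continuous_sin.
Qed.

Lemma continuous_charfun mu l : measurable_fun setT l ->
  continuous (fun s : R => complex.Re (charfun mu (fun x => s * l x))) /\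
  continuous (fun s : R => complex.Im (charfun mu (fun x => s * l x))).
Proof.
move=> ml; split => s; apply/(@cvg_nbhsP _ R^o) => w ws;
  by have [] := cvg_charfun mu ml ws.
Qed.

(* If phi(2l) = 0, then W = C cos l + S sin l, where phi(l) = C + iS, has mean
   C^2 + S^2 and second moment (C^2 + S^2) / 2; its variance is nonnegative. *)
Lemma charfun_double_eq0 mu l : measurable_fun setT l ->
  charfun mu (fun x => 2 * l x) = 0 ->
  complex.Re (charfun mu l) ^+ 2 + complex.Im (charfun mu l) ^+ 2 <= 2^-1.
Proof.
move=> ml [C20 S20] /=.
set C := (\int[mu]_x cos (l x))%R; set S := (\int[mu]_x sin (l x))%R.
have ml2 : measurable_fun setT (fun x => 2 * l x) by exact: measurable_funM.
have bc := bounded_measurable_cos ml; have bs := bounded_measurable_sin ml.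
have bc2 := bounded_measurable_cos ml2; have bs2 := bounded_measurable_sin ml2.
set r := C ^+ 2 + S ^+ 2.
have : 0 <= (\int[mu]_x (C * cos (l x) + S * sin (l x) - r) ^+ 2)%R.
  by apply: Rintegral_ge0 => x _; exact: sqr_ge0.
have -> : (\int[mu]_x (C * cos (l x) + S * sin (l x) - r) ^+ 2 =
  \int[mu]_x ((((C ^+ 2 - S ^+ 2) / 2 * cos (2 * l x) + C * S * sin (2 * l x)) +
    ((- (2 * r * C)) * cos (l x) + (- (2 * r * S)) * sin (l x))) + (r / 2 + r ^+ 2)))%R.
  apply: eq_Rintegral => x _.
  have -> : 2 * l x = l x + l x by ring.
  rewrite cosD sinD /r; have := cos2Dsin2 (l x).
  move: (cos (l x)) (sin (l x)) => c s cs.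
  have -> : s * s = 1 - c * c by rewrite -cs; ring.
  have e : s ^+ 2 = 1 - c ^+ 2 by rewrite -cs; ring.
  transitivity (C ^+ 2 * c ^+ 2 + S ^+ 2 * s ^+ 2 + 2 * C * S * c * s
    - 2 * (C ^+ 2 + S ^+ 2) * (C * c + S * s) + (C ^+ 2 + S ^+ 2) ^+ 2); first by ring.
  by rewrite e; field.
rewrite RintegralD_bounded; last 2 first.
- by do 2 apply: bounded_measurableD; exact: bounded_measurableZ.
- exact: bounded_measurable_cst.
rewrite Rintegral_probability_cst RintegralD_bounded; last 2 first.
- by apply: bounded_measurableD; exact: bounded_measurableZ.
- by apply: bounded_measurableD; exact: bounded_measurableZ.
rewrite !RintegralD_bounded; try exact: bounded_measurableZ.
rewrite !RintegralZ_bounded// C20 S20 -/C -/S => h.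
have {}h : 0 <= r / 2 - r ^+ 2.
  by move: h; congr (_ <= _); rewrite /r; field.
have [r0|r0] := leP r 0; first by rewrite (le_trans r0).
have : 0 <= r * (2^-1 - r) by move: h; congr (_ <= _); field.
by rewrite pmulr_rge0// subr_ge0.
Qed.

End charfun.

Lemma charfun_convolution (R : realType) (V : normedModType R)
    (mu1 mu2 : probability (borel V) R) (l : V -> R) :
  measurable_fun [set: borel V] l -> (forall x y, l (x + y) = l x + l y) ->
  charfun (convolution mu1 mu2) l = charfun mu1 l * charfun mu2 l.
Proof.
move=> ml lD; rewrite /charfun.
have bc := bounded_measurable_cos ml; have bs := bounded_measurable_sin ml.
rewrite !Rintegral_convolution//.
set C1 := (\int[mu1]_x cos (l x))%R; set S1 := (\int[mu1]_x sin (l x))%R.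
have -> : (\int[mu2]_y \int[mu1]_x cos (l (x + y)))%R =
    (\int[mu2]_y (C1 * cos (l y) + (- S1) * sin (l y)))%R.
  apply: eq_Rintegral => y _.
  transitivity (\int[mu1]_x (cos (l y) * cos (l x) + (- sin (l y)) * sin (l x)))%R.
    by apply: eq_Rintegral => x _; rewrite lD cosD; ring.
  rewrite RintegralD_bounded; [|exact: bounded_measurableZ..].
  by rewrite !RintegralZ_bounded// -/C1 -/S1; ring.
have -> : (\int[mu2]_y \int[mu1]_x sin (l (x + y)))%R =
    (\int[mu2]_y (S1 * cos (l y) + C1 * sin (l y)))%R.
  apply: eq_Rintegral => y _.
  transitivity (\int[mu1]_x (cos (l y) * sin (l x) + sin (l y) * cos (l x)))%R.
    by apply: eq_Rintegral => x _; rewrite lD sinD; ring.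
  rewrite RintegralD_bounded; [|exact: bounded_measurableZ..].
  by rewrite !RintegralZ_bounded// -/C1 -/S1; ring.
rewrite !RintegralD_bounded; try exact: bounded_measurableZ.
rewrite !RintegralZ_bounded//.
by apply/eqP; rewrite eq_complex /=; apply/andP; split; apply/eqP; ring.
Qed.

Lemma charfun_power (R : realType) (V : normedModType R) (k : nat)
    (mu : probability (borel V) R) (l : V -> R) :
  measurable_fun [set: borel V] l -> (forall x y, l (x + y) = l x + l y) ->
  (0 < k)%N -> charfun (convolution_power k mu) l = charfun mu l ^+ k.
Proof.
move=> ml lD; case: k => // k _.
elim: k => [|k ih]; first by rewrite expr1.
by rewrite /convolution_power/= charfun_convolution// exprSr -ih.
Qed.

(** * Zeros and uniqueness of roots *)

Section infinitely_divisible.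
Context (R : realType) (V : normedModType R) (mu : probability (borel V) R).
Hypothesis idmu : infinitely_divisible mu.

(** The squared modulus as a real number. It is multiplicative and polynomial in the coordinates, so
    real limits and the intermediate value theorem apply. *)
Let sqn (z : R[i]) := complex.Re z ^+ 2 + complex.Im z ^+ 2.

Let sqnM z w : sqn (z * w) = sqn z * sqn w.
Proof. by case: z w => [a b] [c e]; rewrite /sqn /=; ring. Qed.

Let sqnX z n : sqn (z ^+ n) = sqn z ^+ n.
Proof.
elim: n => [|n ih]; last by rewrite !exprS sqnM ih.
by rewrite !expr0 /sqn /= expr1n expr0n addr0.
Qed.

Let sqn_ge0 z : 0 <= sqn z.
Proof. by rewrite addr_ge0 ?sqr_ge0. Qed.

Let sqn_eq0 z : sqn z = 0 -> z = 0.
Proof.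
case: z => [a b] /eqP; rewrite /sqn /= paddr_eq0 ?sqr_ge0// !sqrf_eq0.
by move=> /andP[/eqP-> /eqP->].
Qed.

Lemma charfun_neq0 (l : V -> R) :
  measurable_fun [set: borel V] l -> (forall x y, l (x + y) = l x + l y) ->
  charfun mu l != 0.
Proof.
move=> ml lD; pose ls (s : R) := fun x => s * l x.
have mls s : measurable_fun [set: borel V] (ls s) by exact: measurable_funM.
have lsD s x y : ls s (x + y) = ls s x + ls s y by rewrite /ls lD mulrDr.
have half s : charfun mu (ls (2 * s)) = 0 -> charfun mu (ls s) = 0.
  move=> h; apply: sqn_eq0; apply/eqP; rewrite eq_le sqn_ge0 andbT leNgt.
  apply/negP => p0.
  have hk k : sqn (charfun mu (ls s)) <= 2^-1 ^+ k.+1.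
    have [nu nuE] := idmu (ltn0Sn k).
    have muE (l' : V -> R) : measurable_fun [set: borel V] l' ->
        (forall x y, l' (x + y) = l' x + l' y) -> charfun mu l' = charfun nu l' ^+ k.+1.
      by move=> ml' l'D; rewrite -charfun_power//; exact: eq_charfun.
    rewrite muE// sqnX lerXn2r ?nnegrE//; apply: charfun_double_eq0 => //.
    move: h; rewrite muE// => /eqP; rewrite expf_eq0/= => /eqP <-.
    by congr charfun; apply/funext => x; rewrite /ls mulrA.
  have cp : (fun k => (2^-1 : R) ^+ k.+1) @ \oo --> (0 : R).
    rewrite (_ : (fun k => _) = (fun k => (2^-1 : R) ^+ (k + 1))); last first.
      by apply/funext => k; rewrite addn1.
    rewrite (cvg_shiftn 1 (fun k => (2^-1 : R) ^+ k)); apply: cvg_expr.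
    by rewrite ger0_norm ?invr_ge0// invf_lt1// ltr1n.
  have : sqn (charfun mu (ls s)) <= 0.
    by apply: (cvgr_to_ge cp); exact: nearW.
  by rewrite leNgt p0.
apply/eqP => phi0.
have phin n : charfun mu (ls (2^-1 ^+ n)) = 0.
  elim: n => [|n ih].
    by rewrite expr0 -[RHS]phi0; congr charfun; apply/funext => x; rewrite /ls mul1r.
  by apply: half; rewrite exprS mulrA mulfV// mul1r.
have c0 : (fun n => (2^-1 : R) ^+ n) @ \oo --> (0 : R).
  by apply: cvg_expr; rewrite ger0_norm ?invr_ge0// invf_lt1// ltr1n.
have [cR _] := cvg_charfun mu ml c0.
have : (fun n => complex.Re (charfun mu (fun x => 2^-1 ^+ n * l x))) @ \oo --> (0 : R).
  rewrite (_ : (fun n => _) = cst 0); first exact: cvg_cst.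
  by apply/funext => n; rewrite (phin n).
rewrite (_ : (fun x => 0 * l x) = cst 0) in cR; last first.
  by apply/funext => x; rewrite mul0r.
rewrite charfun0/= in cR.
by move=> /(cvg_unique (@Rhausdorff R) cR)/eqP; rewrite oner_eq0.
Qed.

Lemma charfun_root_unique (k : nat) (nu1 nu2 : probability (borel V) R)
    (l : V -> R) : (0 < k)%N ->
  (forall A, measurable A -> mu A = convolution_power k nu1 A) ->
  (forall A, measurable A -> mu A = convolution_power k nu2 A) ->
  measurable_fun [set: borel V] l -> (forall x y, l (x + y) = l x + l y) ->
  charfun nu1 l = charfun nu2 l.
Proof.
move=> k0 nu1E nu2E ml lD; pose ls (s : R) := fun x => s * l x.
have mls s : measurable_fun [set: borel V] (ls s) by exact: measurable_funM.
have lsD s x y : ls s (x + y) = ls s x + ls s y by rewrite /ls lD mulrDr.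
pose z s := charfun nu1 (ls s); pose w s := charfun nu2 (ls s).
have zw s : z s ^+ k = w s ^+ k.
  rewrite -!charfun_power//; apply: eq_charfun => A mA.
  by rewrite -nu1E// nu2E.
have w0 s : w s != 0.
  have := charfun_neq0 (mls s) (lsD s).
  by rewrite (eq_charfun _ nu2E) charfun_power// expf_eq0 k0.
(* The squared distance from 1 to z s / w s, in a form whose continuity is that of real functions.
   By [gap] it takes no value strictly between 0 and 1/k^2; if E 1 were not 0, the intermediate
   value theorem would produce half of that bound. *)
pose E s := sqn (z s - w s) / sqn (w s).
have sqnw s : sqn (w s) != 0 by apply: contra_neq (w0 s); exact: sqn_eq0.
have gap s : E s = 0 \/ (k%:R ^+ 2)^-1 <= E s.
  have [zw0|zwn] := eqVneq (z s) (w s).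
    by left; rewrite /E zw0 subrr /sqn /= expr0n addr0 mul0r.
  right; set q := z s / w s.
  have qk : q ^+ k = 1 by rewrite expr_div_n zw divff// expf_neq0.
  have q1 : q != 1.
    by apply: contra_neq zwn => e; rewrite -[z s](divfK (w0 s)) -/q e mul1r.
  have -> : E s = sqn (q - 1).
    by rewrite -[RHS](mulfK (sqnw s)) -sqnM mulrBl divfK// mul1r.
  have := unity_root_gap k0 qk q1.
  rewrite normc_def -(rmorph_nat (real_complex R)) -rmorphM lecR -/(sqn (q - 1)) => h.
  rewrite -[leLHS]mulr1 ler_pdivrMl ?exprn_gt0 ?ltr0n//.
  rewrite -(sqr_sqrtr (sqn_ge0 (q - 1))) -exprMn.
  by rewrite exprn_ege1.
have cE : continuous E.
  have [cz1 cz2] := continuous_charfun nu1 ml.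
  have [cw1 cw2] := continuous_charfun nu2 ml.
  have -> : E = fun s => ((complex.Re (z s) - complex.Re (w s)) ^+ 2 +
      (complex.Im (z s) - complex.Im (w s)) ^+ 2) / sqn (w s).
    by apply/funext => s; rewrite /E; case: (z s) (w s) => [a b] [c e].
  move=> s; apply: cvgM.
    by apply: cvgD; rewrite !expr2; apply: cvgM; apply: cvgB;
      [exact: cz1|exact: cw1|exact: cz1|exact: cw1|
       exact: cz2|exact: cw2|exact: cz2|exact: cw2].
  apply: cvgV; first exact: sqnw.
  by apply: cvgD; rewrite !expr2; apply: cvgM; [exact: cw1|exact: cw1|exact: cw2|exact: cw2].
have E0 : E 0 = 0.
  have l0 : ls 0 = cst 0 by apply/funext => x; rewrite /ls mul0r.
  by rewrite /E /z /w l0 !charfun0 subrr /sqn /= expr0n addr0 mul0r.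
have l1 : ls 1 = l by apply/funext => x; rewrite /ls mul1r.
have [E1|E1] := gap 1.
  move: E1; rewrite /E => /eqP; rewrite mulf_eq0 invr_eq0 (negbTE (sqnw 1)) orbF.
  by move=> /eqP/sqn_eq0/eqP; rewrite subr_eq0 /z /w l1 => /eqP.
exfalso; pose v : R := (k%:R ^+ 2)^-1 / 2.
have v0 : 0 < (k%:R ^+ 2)^-1 :> R by rewrite invr_gt0 exprn_gt0 ?ltr0n.
have vv : v < (k%:R ^+ 2)^-1 by rewrite ltr_pdivrMr// ltr_pMr// ltr1n.
have vp : 0 < v by rewrite divr_gt0.
have [c _ cv] : exists2 c, c \in `[(0 : R), 1] & E c = v.
  apply: IVT => //; first exact: continuous_subspaceT.
  have E10 : 0 <= E 1 := le_trans (ltW v0) E1.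
  by rewrite E0 min_l// max_r// ltW//= (le_trans (ltW vv)).
have [h|h] := gap c; rewrite cv in h.
  by move: vp; rewrite h ltxx.
by move: vv; rewrite ltNge h.
Qed.

End infinitely_divisible.

Lemma root_rV_unique (R : realType) (n k : nat)
    (mu nu1 nu2 : probability (borel 'rV[R]_n) R) :
  infinitely_divisible mu -> (0 < k)%N ->
  (forall A, measurable A -> mu A = convolution_power k nu1 A) ->
  (forall A, measurable A -> mu A = convolution_power k nu2 A) ->
  forall A, measurable A -> nu1 A = nu2 A.
Proof.
move=> idmu k0 nu1E nu2E.
have h t : charfun nu1 (dot t) = charfun nu2 (dot t).
  apply: (charfun_root_unique idmu k0 nu1E nu2E); last by move=> x y; exact: dotD.
  by apply: measurable_continuous_borel; exact: continuous_dot.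
by apply: probability_rV_unique => t; have [] := h t.
Qed.

(** * Cylindrical roots *)

Lemma image_probability d d' (T : measurableType d) (T' : measurableType d')
    (R : realType) (f : T -> T') (mu : probability T R) :
  measurable_fun setT f ->
  exists nu : probability T' R, forall A, nu A = mu (f @^-1` A).
Proof.
move=> mf; pose mix := isMeasurableFun.Build _ _ _ _ f mf.
pose X : {mfun T >-> T'} := HB.pack f mix.
by exists (distribution mu X).
Qed.

Section linear_image.
Context (R : realType) (V W : normedModType R) (h : V -> W).
Hypotheses (mh : measurable_fun [set: borel V] (h : borel V -> borel W))
  (hD : forall x y, h (x + y) = h x + h y).

(** Additivity of h turns translation by h y into the preimage of translation by y. With h the
    identity this shows that a convolution depends on its factors only through their values on
    measurable sets. *)
Lemma convolution_pushforward (mu1 mu2 : probability (borel V) R)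
    (nu1 nu2 : probability (borel W) R) :
  (forall A : set (borel W), measurable A -> nu1 A = mu1 (h @^-1` A)) ->
  (forall A : set (borel W), measurable A -> nu2 A = mu2 (h @^-1` A)) ->
  forall A : set (borel W), measurable A ->
    convolution nu1 nu2 A = convolution mu1 mu2 (h @^-1` A).
Proof.
move=> h1 h2 A mA; rewrite /convolution.
transitivity (\int[pushforward mu2 (h : borel V -> borel W)]_y
    nu1 [set x | A (x + y)%R])%E.
  by apply: eq_measure_integral => B mB _; exact: h2.
rewrite ge0_integral_pushforward//; last exact: measurable_translate_measure.
rewrite preimage_setT; apply: eq_integral => y _ /=.
rewrite h1; last exact: measurable_translate.
by congr (mu1 _); apply/seteqP; split => x /=; rewrite hD.
Qed.

Lemma convolution_power_pushforward k (mu : probability (borel V) R)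
    (nu : probability (borel W) R) :
  (forall A : set (borel W), measurable A -> nu A = mu (h @^-1` A)) ->
  forall A : set (borel W), measurable A ->
    convolution_power k nu A = convolution_power k mu (h @^-1` A).
Proof.
move=> nuE; rewrite /convolution_power.
by elim: k.-1 => //= n ih; exact: convolution_pushforward.
Qed.

End linear_image.

Lemma eq_convolution_power (R : realType) (V : normedModType R) k
    (mu nu : probability (borel V) R) :
  (forall A : set (borel V), measurable A -> mu A = nu A) ->
  forall A : set (borel V), measurable A ->
    convolution_power k mu A = convolution_power k nu A.
Proof.
by move=> h A mA; apply: (@convolution_power_pushforward _ _ _ (id : V -> V)) => //.
Qed.

Section dual_proj.
Context (R : realType) (U : normedModType R).

Lemma dual_projZ n (a : 'I_n -> dual U) c u :
  dual_proj a (c *: u) = c *: dual_proj a u.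
Proof. by apply/rowP => i; rewrite !mxE linearZ. Qed.

(* dual_proj a need not be onto; P projects onto its range. *)
Lemma dual_proj_range n (a : 'I_n -> dual U) : exists P : 'M[R]_n,
  (forall u, dual_proj a u *m P = dual_proj a u) /\
  (forall x, exists u, dual_proj a u = x *m P).
Proof.
(* M is a matrix of maximal rank whose row space lies in the range. A vector of the range outside
   this row space would raise the rank, so the two coincide, and [pinvmx M *m M] projects onto
   them. *)
pose W v := exists u, dual_proj a u = v.
pose ok (M : 'M[R]_n) := forall v : 'rV_n, (v <= M)%MS -> W v.
pose rk r := `[< exists2 M, ok M & \rank M = r >].
have rk0 : exists r, rk r.
  exists 0; apply/asboolP; exists 0; last exact: mxrank0.
  move=> v; rewrite submx0 => /eqP ->; exists 0.
  by apply/rowP => i; rewrite !mxE linear0.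
have rkn r : rk r -> (r <= n)%N.
  by move=> /asboolP[M _ <-]; exact: rank_leq_row.
case: (ex_maxnP rk0 rkn) => r /asboolP[M okM Mr] rmax.
have MW u : (dual_proj a u <= M)%MS.
  apply: contraT => uM; pose v := dual_proj a u.
  have MMv : (M < M + v)%MS.
    by rewrite ltmxE addsmxSl /=; apply: contra uM; apply: submx_trans; exact: addsmxSr.
  suff /rmax : rk (\rank (M + v)).
    by rewrite -Mr leqNgt (rank_ltmx MMv).
  apply/asboolP; exists (M + v)%MS => // w /sub_addsmxP[[w1 w2] /= ->].
  have [u1 u1E] := okM _ (submxMl w1 M).
  exists (u1 + w2 ord0 ord0 *: u); rewrite dual_projD u1E dual_projZ.
  by congr (_ + _); rewrite -mul_scalar_mx [w2 in RHS]mx11_scalar.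
exists (pinvmx M *m M); split => [u|x]; first by rewrite mulmxA mulmxKpV.
by rewrite mulmxA; apply: okM; exact: submxMl.
Qed.

Definition dual_cat m n (a : 'I_m -> dual U) (b : 'I_n -> dual U)
    (i : 'I_(m + n)) : dual U :=
  match fintype.split i with inl j => a j | inr j => b j end.

Lemma dual_proj_cat m n (a : 'I_m -> dual U) (b : 'I_n -> dual U) u :
  dual_proj (dual_cat a b) u = row_mx (dual_proj a u) (dual_proj b u).
Proof.
by apply/rowP => i; rewrite !mxE /dual_cat; case: fintype.split => j; rewrite mxE.
Qed.

(** The empty family; its projection into the one-point space exhibits [set0] and [setT] as
    cylinders. *)
Definition no_dual (i : 'I_0) : dual U :=
  match i with Ordinal _ i0 => False_rect _ (notF i0) end.

Lemma measurable_mulmx m n (P : 'M[R]_(m, n)) :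
  measurable_fun [set: borel 'rV[R]_m]
    ((fun x : 'rV[R]_m => x *m P) : borel 'rV[R]_m -> borel 'rV[R]_n).
Proof.
apply: measurable_fun_borel; apply: row_continuous => i.
have -> : (fun x : 'rV[R]_m => (x *m P) ord0 i) = dot (\row_j P j i).
  by apply/funext => x; rewrite /dot mxE; apply: eq_bigr => j _; rewrite mxE mulrC.
exact: continuous_dot.
Qed.

End dual_proj.

Lemma cylindrical_image_power (R : realType) (U : normedModType R) k
    (mu : cylindrical_probability U) n (a : 'I_n -> dual U)
    (B : set (borel 'rV[R]_n)) : measurable B ->
  cylindrical_power k mu (dual_proj a @^-1` B) =
  convolution_power k (cylindrical_image mu a) B.
Proof.
rewrite /cylindrical_power /convolution_power.
elim: k.-1 B => [|j ih] B mB//=.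
rewrite cylindrical_convolutionE//.
have id_meas : measurable_fun [set: borel 'rV[R]_n]
  (id : borel 'rV[R]_n -> borel 'rV[R]_n) by exact: measurable_id.
by apply: (convolution_pushforward id_meas) => // A mA; exact: ih.
Qed.

Section cylindrical_root.
Context (R : realType) (U : normedModType R) (mu : cylindrical_probability U).
Hypothesis wid : weakly_infinitely_divisible mu.
Variable k : nat.
Hypothesis k0 : (0 < k)%N.

Definition image_root n (a : 'I_n -> dual U) : probability (borel 'rV[R]_n) R :=
  sval (cid (wid a k0)).

Lemma image_rootE n (a : 'I_n -> dual U) (B : set (borel 'rV[R]_n)) :
  measurable B -> cylindrical_image mu a B = convolution_power k (image_root a) B.
Proof. exact: (svalP (cid (wid a k0))). Qed.

(** The image of the root for b under P is also a k-th root of the image of [mu] for a, since P is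
    additive; uniqueness of roots identifies it with the chosen one. *)
Lemma image_root_mulmx m n (a : 'I_n -> dual U) (b : 'I_m -> dual U)
    (P : 'M[R]_(m, n)) :
  (forall u, dual_proj b u *m P = dual_proj a u) ->
  forall B : set (borel 'rV[R]_n), measurable B ->
    image_root a B = image_root b [set x : 'rV[R]_m | B (x *m P)].
Proof.
move=> baP; have mP := measurable_mulmx P.
have [nu nuE] := image_probability (image_root b) mP.
move=> B mB; rewrite -[RHS]nuE.
apply: (root_rV_unique (wid a) k0) mB => A mA; first exact: image_rootE.
rewrite (convolution_power_pushforward mP _ k (fun A _ => nuE A))//; last first.
  by move=> x y; exact: mulmxDl.
rewrite -image_rootE; last by rewrite -[X in measurable X]setTI; exact: mP.
by congr (mu _); apply/seteqP; split => u /=; rewrite baP.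
Qed.

(** Equality of the cylinders relates A and B only over the range of the joint projection c, and a
    root is not a priori carried by this range. Inserting P moves every test point x to x P, which
    lies in the range. *)
Lemma image_root_uniq n (a : 'I_n -> dual U) (A : set (borel 'rV[R]_n))
    m (b : 'I_m -> dual U) (B : set (borel 'rV[R]_m)) :
  measurable A -> measurable B -> dual_proj a @^-1` A = dual_proj b @^-1` B ->
  image_root a A = image_root b B.
Proof.
move=> mA mB AB.
pose c := dual_cat a b.
have cE u : dual_proj c u = row_mx (dual_proj a u) (dual_proj b u).
  exact: dual_proj_cat.
have [P [cP Pc]] := dual_proj_range c.
rewrite (@image_root_mulmx _ _ a c (P *m col_mx 1%:M 0))
  ?(@image_root_mulmx _ _ b c (P *m col_mx 0 1%:M))//.
- congr (image_root c _); apply/seteqP; split => x /=; have [u uE] := Pc x;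
  rewrite !mulmxA -uE cE !mul_row_col !mulmx1 !mulmx0 ?addr0 ?add0r => h.
  + by have : (dual_proj b @^-1` B) u by rewrite -AB.
  + by have : (dual_proj a @^-1` A) u by rewrite AB.
- by move=> u; rewrite mulmxA cP cE mul_row_col mulmx1 mulmx0 add0r.
- by move=> u; rewrite mulmxA cP cE mul_row_col mulmx1 mulmx0 addr0.
Qed.

Lemma cylindrical_root_exists : exists nu : cylindrical_probability U,
  (forall n (a : 'I_n -> dual U) (B : set (borel 'rV[R]_n)), measurable B ->
    nu (dual_proj a @^-1` B) = image_root a B) /\
  forall Z, cylinder setT Z -> mu Z = cylindrical_power k nu Z.
Proof.
pose P (Z : set U) (x : \bar R) :=
  exists n (a : 'I_n -> dual U) (B : set (borel 'rV[R]_n)),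
    [/\ measurable B, Z = dual_proj a @^-1` B & x = image_root a B].
(* The value is unique on cylinders; elsewhere the default 0 is immaterial. *)
pose nu (Z : set U) : \bar R := xget 0%E [set x | P Z x].
have nuE n (a : 'I_n -> dual U) (B : set (borel 'rV[R]_n)) : measurable B ->
    nu (dual_proj a @^-1` B) = image_root a B.
  move=> mB; apply: xget_unique; first by exists n, a, B.
  by move=> _ [m [b [C [mC BC ->]]]]; exact: image_root_uniq.
have nu_ge0 Z : (0 <= nu Z)%E.
  by rewrite /nu; case: xgetP => // _ _ [n [a [B [_ _ ->]]]].
have nu_measure (G : set (dual U)) : finite_set G ->
    exists m : {measure set (g_sigma_algebraType (cylinder G)) -> \bar R},
      forall Z, (cylinder G).-sigma.-measurable Z -> nu Z = m Z.
  move=> fG; have [n [e GE]] := finite_dual_range fG; subst G.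
  have [Q [eQ Qe]] := dual_proj_range e.
  (* s lifts x Q to a point of U and carries the root on R^n back to U. An arbitrary choice is
     measurable here, because cylinders over e see s only as multiplication by Q. *)
  have [s sE] := choice Qe.
  have ms : measurable_fun [set: borel 'rV[R]_n]
      (s : borel 'rV[R]_n -> g_sigma_algebraType (cylinder (range e))).
    move=> _ Z /cylinder_sigmaE[B mB ->]; rewrite setTI.
    have -> : s @^-1` (dual_proj e @^-1` B) = (fun x => x *m Q) @^-1` B.
      by apply/seteqP; split => x /=; rewrite sE.
    by rewrite -[X in measurable X]setTI; exact: measurable_mulmx.
  have [m mE] := image_probability (image_root e) ms.
  exists m => Z /cylinder_sigmaE[B mB ->].
  rewrite [RHS]mE nuE// (image_root_mulmx eQ)//.
  by congr (image_root e _); apply/seteqP; split => x /=; rewrite sE.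
have nu_setT : nu setT = 1%E.
  rewrite -(preimage_setT (dual_proj (@no_dual R U))) nuE//.
  exact: probability_setT.
exists (CylindricalProbability nu_ge0 nu_measure nu_setT); split=> //.
move=> _ [n [a [B [_ mB ->]]]]; rewrite cylindrical_image_power//.
rewrite [LHS](image_rootE a mB).
by apply: eq_convolution_power => // A mA; rewrite -nuE.
Qed.

End cylindrical_root.

Lemma cylindrical_infinitely_divisibleP (R : realType) (U : normedModType R)
    (mu : cylindrical_probability U) :
  cylindrical_infinitely_divisible mu <-> weakly_infinitely_divisible mu.
Proof.
split=> [idmu n a k k0|wid k k0]; last first.
  by have [nu [_ nuE]] := cylindrical_root_exists wid k0; exists nu.
have [nu nuE] := idmu k k0; exists (cylindrical_image nu a) => B mB.
by rewrite -cylindrical_image_power// -nuE//; exists n, a, B.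
Qed.

(** * Tightness of roots *)

Section compact_sets.
Context (R : realType) (V : normedModType R).
Implicit Types A B K : set V.

Lemma open_borel A : open A -> measurable (A : set (borel V)).
Proof. exact: sub_sigma_algebra. Qed.

Lemma closed_borel A : closed A -> measurable (A : set (borel V)).
Proof.
move=> cA; rewrite -[A]setCK; apply: measurableC; apply: open_borel.
exact: closed_openC.
Qed.

Lemma compact_borel K : compact K -> measurable (K : set (borel V)).
Proof.
by move=> cK; apply: closed_borel; apply: compact_closed => //; exact: norm_hausdorff.
Qed.

Lemma compact_image2 (W X : normedModType R) (f : V * W -> X) A (B : set W) :
  continuous f -> compact A -> compact B ->
  compact [set f (x, y) | x in A & y in B].
Proof.
move=> cf cA cB.
have -> : [set f (x, y) | x in A & y in B] = f @` (A `*` B).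
  apply/seteqP; split => [_ [x Ax [y By <-]]|_ [[x y] [Ax By] <-]].
    by exists (x, y).
  by exists x => //; exists y.
by apply: continuous_compact; [exact: continuous_subspaceT|exact: compact_setX].
Qed.

Lemma compact_sumset A B : compact A -> compact B ->
  compact [set x + y | x in A & y in B].
Proof.
move=> cA cB; apply: (@compact_image2 V V (fun p => p.1 + p.2)) => //.
exact: add_continuous.
Qed.

Fixpoint sumset (k : nat) A : set V :=
  if k is k'.+1 then [set x + y | x in sumset k' A & y in A] else [set 0].

Lemma compact_sumset_iter k K : compact K -> compact (sumset k K).
Proof.
by move=> cK; elim: k => [|k ih] /=; [exact: compact_set1|exact: compact_sumset].
Qed.

(** Moves the translation out of the sumset: if y in K lies in the k-fold sumset of K - z, then k z
    is an element of the k-fold sumset of K minus y. This is where the formula for [spread] comes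
    from. *)
Lemma sumset_translate k A z x :
  sumset k [set x | A (x + z)] x -> sumset k A (x + z *+ k).
Proof.
elim: k x => [|k ih] x /=; first by move=> ->; rewrite mulr0n addr0.
move=> [y /ih Ay [w Aw <-]]; exists (y + z *+ k) => //; exists (w + z) => //.
by rewrite mulrSr addrACA.
Qed.

(* Contains every translate of K whose k-fold sumset meets K. *)
Definition spread k K : set V :=
  [set x - p | x in K & p in
    [set k%:R^-1 *: (s - y) | s in sumset k K & y in K]].

Lemma compact_spread k K : compact K -> compact (spread k K).
Proof.
move=> cK; apply: (@compact_image2 V V (fun p => p.1 - p.2)) => //.
  move=> p; apply: cvgB; [exact: cvg_fst|exact: cvg_snd].
apply: (@compact_image2 V V (fun p => k%:R^-1 *: (p.1 - p.2))) => //.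
  move=> p; apply: cvgZr; apply: cvgB; [exact: cvg_fst|exact: cvg_snd].
exact: compact_sumset_iter.
Qed.

End compact_sets.

(** Lets one compact set of U serve all projections: a bound by the spread of the image of K becomes
    a bound by the image of the spread of K. *)
Lemma spread_image (R : realType) (V W : normedModType R) (h : {linear V -> W})
    k (K : set V) : spread k (h @` K) `<=` h @` spread k K.
Proof.
have hsum x : sumset k (h @` K) x -> exists2 y, sumset k K y & h y = x.
  elim: k x => [|k ih] x /=; first by move=> ->; exists 0 => //; rewrite linear0.
  move=> [_ /ih[y Ky <-] [_ [w Kw <-] <-]]; exists (y + w); last exact: linearD.
  by exists y => //; exists w.
move=> _ [_ [x Kx <-] [_ [s /hsum[t Kt ht] [_ [y Ky <-] <-]] <-]].
exists (x - k%:R^-1 *: (t - y)); last by rewrite linearB linearZ linearB ht.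
by exists x => //; exists (k%:R^-1 *: (t - y)) => //; exists t => //; exists y.
Qed.

(** * Concentration of convolution powers *)

Section convolution_concentration.
Context (R : realType) (V : normedModType R).
Local Open Scope ereal_scope.

(** A mean above c has a value above c. The measure of A under a power is a mean of measures of
    translates of A under the preceding power, so induction removes one factor at a time. *)
Lemma convolution_power_translate k (nu : probability (borel V) R)
    (A : set (borel V)) (c : \bar R) : (0 < k)%N -> 0 <= c -> measurable A ->
  c < convolution_power k nu A -> exists z : V, c < nu [set x : V | A (x + z)%R].
Proof.
case: k => // k _ c0; elim: k A => [|k ih] A mA.
  rewrite /convolution_power/= => h; exists 0%R.
  by rewrite (_ : [set x | _] = A)//; apply/seteqP; split => x /=; rewrite addr0.
rewrite [X in c < X -> _](_ : _ = convolution (convolution_power k.+1 nu) nu A)// => h.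
have [y cy] : exists y : V, c < convolution_power k.+1 nu [set x : V | A (x + y)%R].
  apply: contrapT => /forallNP H; move: h; apply/negP; rewrite -leNgt.
  apply: (@le_trans _ _ (\int[nu]_y cst c y)); last first.
    rewrite integral_cst// [X in _ * X](_ : _ = 1) ?mule1//; exact: probability_setT.
  apply: ge0_le_integral => //.
  - exact: measurable_translate_measure.
  - by move=> y _; rewrite leNgt; apply/negP; exact: H.
have [z cz] := ih _ (measurable_translate y mA) cy.
exists (z + y)%R; rewrite (_ : [set x | _] = [set x | A (x + z + y)%R])//.
by apply/seteqP; split => x /=; rewrite addrA.
Qed.

Lemma convolution_sumset (mu1 mu2 : probability (borel V) R)
    (A B C : set (borel V)) : measurable A -> measurable B -> measurable C ->
  (forall x y : V, A x -> B y -> C (x + y)%R) ->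
  mu1 A * mu2 B <= convolution mu1 mu2 C.
Proof.
move=> mA mB mC ABC.
have mf : measurable_fun [set: borel V] (fun y : V => mu1 [set x : V | C (x + y)%R]).
  exact: measurable_translate_measure.
rewrite -[X in _ * X]/(mu2 B) -integral_cst//.
apply: (@le_trans _ _ (\int[mu2]_(y in B) mu1 [set x : V | C (x + y)%R])).
  apply: ge0_le_integral => //.
    exact: measurable_funTS.
  move=> y By; apply: le_measure; rewrite ?inE//.
    exact: measurable_translate.
  by move=> x Ax; exact: ABC.
exact: ge0_subset_integral.
Qed.

Lemma convolution_power_sumset k (nu : probability (borel V) R) (K : set V)
    (r : R) : (0 < k)%N -> (0 <= r)%R -> compact K -> r%:E <= nu K ->
  (r ^+ k)%:E <= convolution_power k nu (sumset k K).
Proof.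
move=> + r0 cK rK; case: k => // k _; elim: k => [|k ih].
  rewrite expr1 /convolution_power/= (_ : [set _ | _ in _ & _ in _] = K)//.
  apply/seteqP; split => [_ [_ -> [x Kx <-]]|x Kx]; first by rewrite add0r.
  by exists 0%R => //; exists x => //; rewrite add0r.
have -> : convolution_power k.+2 nu = convolution (convolution_power k.+1 nu) nu by [].
have mS j : measurable (sumset j K : set (borel V)).
  by apply: compact_borel; exact: compact_sumset_iter.
have mK : measurable (K : set (borel V)) by exact: compact_borel.
apply: le_trans (convolution_sumset _ _ (mS k.+1) mK (mS k.+2) _).
  by rewrite exprSr EFinM; apply: lee_pmul; rewrite ?lee_fin ?exprn_ge0.
by move=> x y Sx Ky; exists x => //; exists y.
Qed.

(** The condition on e makes (1 - e) + (1 - e)^k exceed 1. So K and the k-fold sumset of the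
    translate, whose masses under mu are bounded below by these two terms, must meet. *)
Lemma root_tight k (mu nu : probability (borel V) R) (K : set V) (e : R) :
  (0 < k)%N -> (e < 1)%R -> (e < (1 - e) ^+ k)%R ->
  (forall A, measurable A -> mu A = convolution_power k nu A) ->
  compact K -> (1 - e)%:E < mu K -> (1 - e)%:E < nu (spread k K).
Proof.
move=> k0 e1 ek muE cK muK.
have mK : measurable (K : set (borel V)) by exact: compact_borel.
have [z nuz] : exists z : V, (1 - e)%:E < nu [set x : V | K (x + z)%R].
  apply: (convolution_power_translate k0) => //; last by rewrite -muE.
  by rewrite lee_fin subr_ge0 ltW.
set A := [set x : V | _] in nuz.
have cA : compact A.
  rewrite (_ : A = [set x - z | x in K])%R; last first.
    apply/seteqP; split => [x Ax|_ [x Kx <-]]; last by rewrite /A /= subrK.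
    by exists (x + z)%R => //; rewrite addrK.
  apply: continuous_compact => //; apply: continuous_subspaceT => x.
  by apply: cvgB; [exact: cvg_id|exact: cvg_cst].
have mA : measurable (A : set (borel V)) by exact: compact_borel.
have mS : measurable (sumset k A : set (borel V)).
  by apply: compact_borel; exact: compact_sumset_iter.
have [y [Ky Sy]] : (K `&` sumset k A) !=set0.
  apply/set0P/negP => /eqP KS0.
  have : mu (K `|` sumset k A) <= 1.
    by apply: probability_le1; exact: measurableU.
  rewrite measureU// leNgt => /negP; apply.
  have SE : (((1 - e) ^+ k)%:E <= mu (sumset k A)).
    rewrite muE//; apply: convolution_power_sumset => //; last exact: ltW.
    by rewrite subr_ge0 ltW.
  apply: (@lt_le_trans _ _ ((1 - e)%:E + ((1 - e) ^+ k)%:E)).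
    by rewrite -EFinD lte_fin -ltrBlDl opprB addrC subrK.
  by rewrite leeD// ltW.
have Sz := sumset_translate Sy.
apply: (lt_le_trans nuz); apply: le_measure; rewrite ?inE//.
  by apply: compact_borel; exact: compact_spread.
move=> x Kx; exists (x + z)%R => //; exists z; last by rewrite addrK.
exists (y + z *+ k)%R => //; exists y => //.
by rewrite addrAC subrr add0r -[(z *+ k)%R]scaler_nat scalerA mulVf ?scale1r// pnatr_eq0 -lt0n.
Qed.

End convolution_concentration.

Section cylindrical_tightness.
Context (R : realType) (U : normedModType R).
Variables (k : nat) (mu : probability (borel U) R) (nu : cylindrical_probability U).
Hypotheses (k0 : (0 < k)%N) (rmu : radon mu).
Hypothesis muE : forall n (a : 'I_n -> dual U) (B : set (borel 'rV[R]_n)),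
  measurable B ->
  mu (dual_proj a @^-1` B) = convolution_power k (cylindrical_image nu a) B.

(** Tightness is read off from cylinders missing L, because L need not be a cylinder and [nu] has no
    meaningful value there. *)
Lemma cylindrical_root_tight (d : R) : (0 < d)%R -> exists2 L : set U, compact L &
  forall n (a : 'I_n -> dual U) (B : set (borel 'rV[R]_n)), measurable B ->
    dual_proj a @^-1` B `&` L = set0 -> (nu (dual_proj a @^-1` B) <= d%:E)%E.
Proof.
(* By Bernoulli's inequality (1 - e)^k is at least 1 - k e, which exceeds e as soon as (k + 1) e <
   1; the bound 1/(k+2) ensures this. *)
move=> d0; pose e := Num.min d (k.+2%:R^-1).
have e0 : 0 < e by rewrite lt_min d0 invr_gt0/=.
have ed : e <= d by rewrite ge_min lexx.
have ek : e <= k.+2%:R^-1 by rewrite ge_min lexx orbT.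
have e1 : e < 1 by rewrite (le_lt_trans ek)// invf_lt1// ltr1n.
have eke : e < (1 - e) ^+ k.
  have B j : 1 - j%:R * e <= (1 - e) ^+ j.
    elim: j => [|j ih]; first by rewrite mul0r subr0 expr0.
    rewrite exprS (le_trans _ (ler_wpM2l _ ih)) ?subr_ge0 ?(ltW e1)//.
    have : 0 <= j%:R * e ^+ 2 by rewrite mulr_ge0// sqr_ge0.
    by rewrite -natr1; nra.
  apply: lt_le_trans (B k); rewrite ltrBrDr -[X in X + _]mul1r -mulrDl nat1r.
  by rewrite (le_lt_trans (ler_wpM2l _ ek))// ltr_pdivrMr// mul1r ltr_nat.
have [K [cK _ Ke]] := rmu measurableT e0.
have mK : measurable (K : set (borel U)) by exact: compact_borel.
have muK : ((1 - e)%:E < mu K)%E.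
  move: Ke; rewrite setTD probability_setC//.
  have : mu K \is a fin_num by exact: fin_num_measure.
  by case: (mu K) => // r _; rewrite -EFinB !lte_fin; lra.
exists (spread k K); first exact: compact_spread.
move=> n a B mB BL.
have cpK : compact (dual_proj a @` K).
  apply: continuous_compact => //; apply: continuous_subspaceT.
  exact: dual_proj_continuous.
have ca : measurable_fun [set: borel U] (dual_proj a : borel U -> borel 'rV[R]_n).
  by apply: measurable_fun_borel; exact: dual_proj_continuous.
have [mua muaE] := image_probability mu ca.
have tight : ((1 - e)%:E < cylindrical_image nu a (spread k (dual_proj a @` K)))%E.
  apply: (root_tight k0 e1 eke (mu := mua)) => //.
    by move=> A mA; rewrite muaE muE.
  rewrite muaE (lt_le_trans muK)//; apply: le_measure; rewrite ?inE//.
    by rewrite -[X in measurable X]setTI; apply: ca => //; exact: compact_borel.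
  by move=> u Ku; exists u.
have BL0 : B `&` spread k (dual_proj a @` K) = set0.
  apply/seteqP; split => // x [Bx].
  have lina : linear (dual_proj a).
    by move=> c u v; rewrite dual_projD dual_projZ.
  pose h : {linear U -> 'rV[R]_n} :=
    HB.pack (dual_proj a) (GRing.isLinear.Build _ _ _ _ _ lina).
  move=> /(@spread_image R U _ h)[u Lu ux].
  suff : (dual_proj a @^-1` B `&` spread k K) u by rewrite BL.
  by split=> //=; rewrite (ux : dual_proj a u = x).
have mL : measurable (spread k (dual_proj a @` K) : set (borel 'rV[R]_n)).
  by apply: compact_borel; exact: compact_spread.
apply: (@le_trans _ _ e%:E); last by rewrite lee_fin.
have := @probability_le1 _ _ _ (cylindrical_image nu a) _ (measurableU _ _ mB mL).
rewrite measureU// -[X in (X + _)%E]/(nu (dual_proj a @^-1` B)) => h1.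
rewrite leNgt; apply/negP => h2; move: h1; rewrite leNgt => /negP; apply.
apply: lt_le_trans (leeD (ltW h2) (lexx _)).
apply: (@le_lt_trans _ _ (e%:E + (1 - e)%:E)%E); first by rewrite -EFinD lee_fin; lra.
by rewrite lteD2lE.
Qed.

End cylindrical_tightness.

(** * Norming functionals *)

Section norming_functional.
Context (R : realType) (U : normedModType R).
Implicit Types p q : U -> R.

Definition sublinear p :=
  (forall x y, p (x + y) <= p x + p y) /\ (forall c x, 0 < c -> p (c *: x) <= c * p x).

Lemma sublinear0 p : sublinear p -> p 0 = 0.
Proof.
move=> [pD pZ]; have := pD 0 0; have := pZ 2^-1 0; rewrite addr0 scaler0.
by rewrite invr_gt0 ltr0n => /(_ isT); lra.
Qed.

(* The pointwise minimal sublinear functionals are the linear ones: lowering p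
   along y gives a sublinear functional below p whose value at -y is at most
   - p y. *)
Definition lower p y x := inf [set p (x + t *: y) - t * p y | t in [set t | 0 <= t]].

Section lower.
Variables (p : U -> R) (y : U).
Hypothesis sp : sublinear p.

Let has_lb x :
  has_lbound [set p (x + t *: y) - t * p y | t in [set t | 0 <= t]].
Proof.
exists (- p (- x)) => _ [t /= t0 <-].
have [pD pZ] := sp.
have : t * p y <= p (t *: y).
  have := t0; rewrite le_eqVlt => /predU1P[<-|t1].
    by rewrite mul0r scale0r sublinear0.
  rewrite -ler_pdivlMl//; have := pZ t^-1 (t *: y); rewrite scalerA mulVf ?gt_eqF// scale1r.
  by apply; rewrite invr_gt0.
by have := pD (x + t *: y) (- x); rewrite addrC addKr; lra.
Qed.

Let lower_le x t : 0 <= t -> lower p y x <= p (x + t *: y) - t * p y.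
Proof. by move=> t0; apply: ge_inf; [exact: has_lb|exists t]. Qed.

Let le_lower x m : (forall t, 0 <= t -> m <= p (x + t *: y) - t * p y) ->
  m <= lower p y x.
Proof.
move=> h; apply: lb_le_inf; first by exists (p (x + 0 *: y) - 0 * p y), 0 => /=.
by move=> _ [t t0 <-]; exact: h.
Qed.

Lemma lower_sublinear : sublinear (lower p y).
Proof.
have [pD pZ] := sp; split => [x z|c x c0].
  rewrite -lerBlDr; apply: le_lower => t t0.
  rewrite lerBlDr -lerBlDl; apply: le_lower => s s0.
  rewrite lerBlDl (le_trans (lower_le _ (addr_ge0 t0 s0)))//.
  have := pD (x + t *: y) (z + s *: y).
  by rewrite addrACA -scalerDl; lra.
rewrite -ler_pdivrMl//; apply: le_lower => t t0.
rewrite ler_pdivrMl// (le_trans (lower_le _ (mulr_ge0 (ltW c0) t0)))//.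
have := pZ c (x + t *: y) c0.
by rewrite scalerDr scalerA; lra.
Qed.

Lemma lower_le_self x : lower p y x <= p x.
Proof.
by rewrite (le_trans (lower_le x (lexx 0)))// scale0r addr0 mul0r subr0.
Qed.

Lemma lower_opp : lower p y (- y) <= - p y.
Proof.
by rewrite (le_trans (lower_le _ ler01))// scale1r addNr sublinear0// mul1r sub0r.
Qed.

End lower.

(** Zorn's lemma, downwards. The infimum of a chain is subadditive because the smaller of two
    members serves for both arguments, and it is finite because every member p satisfies p x >= - p
    (- x) >= - q (- x). *)
Lemma minimal_sublinear q : sublinear q -> exists2 p, sublinear p &
  (forall x, p x <= q x) /\
  forall p', sublinear p' -> (forall x, p' x <= p x) -> forall x, p x <= p' x.
Proof.
move=> sq; pose T := {p | sublinear p /\ forall x, p x <= q x}.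
pose below (s t : T) := `[< forall x, sval t x <= sval s x >].
have q0 : T by exists q.
have [|||[p [sp pq]] pmin] := ZL_preorder q0 (R := below).
- by move=> t; apply/asboolP.
- by move=> r s t /asboolP rs /asboolP st; apply/asboolP => x; exact: le_trans (rs x).
- move=> A Atot; have [[t0 At0]|A0] := pselect (A !=set0); last first.
    by exists q0 => s As; exfalso; apply: A0; exists s.
  pose V x := [set sval t x | t in A].
  have V0 x : V x !=set0 by exists (sval t0 x), t0.
  have lbV x : has_lbound (V x).
    exists (- q (- x)) => _ [[p [sp pq]] _ <-] /=.
    have [pD _] := sp; have := pD x (- x); rewrite subrr sublinear0//.
    by have := pq (- x); lra.
  have le_V t x : A t -> inf (V x) <= sval t x.
    by move=> At; apply: ge_inf => //; exists t.
  have sV : sublinear (fun x => inf (V x)).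
    split => [x y|c x c0].
      rewrite -lerBlDr; apply: lb_le_inf => // _ [s As <-].
      rewrite lerBlDr -lerBlDl; apply: lb_le_inf => // _ [t At <-].
      rewrite lerBlDl.
      have [/asboolP st|/asboolP ts] := Atot _ _ As At.
        rewrite (le_trans (le_V t _ At))//.
        by have [pD _] := (svalP t).1; rewrite (le_trans (pD _ _))// lerD2r.
      rewrite (le_trans (le_V s _ As))//.
      by have [pD _] := (svalP s).1; rewrite (le_trans (pD _ _))// lerD2l.
    rewrite -ler_pdivrMl//; apply: lb_le_inf => // _ [s As <-].
    rewrite ler_pdivrMl// (le_trans (le_V s _ As))//.
    by have [_ pZ] := (svalP s).1; exact: pZ.
  have Vq x : inf (V x) <= q x.
    by rewrite (le_trans (le_V t0 x At0))//; exact: (svalP t0).2.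
  exists (exist _ (fun x => inf (V x)) (conj sV Vq)) => s As.
  by apply/asboolP => x /=; exact: le_V.
exists p => //; split => // p' sp' p'p.
have p'q x : p' x <= q x by exact: le_trans (p'p x) _.
have /asboolP := pmin (exist _ p' (conj sp' p'q)) (asboolT p'p).
by apply.
Qed.

(** Hahn-Banach by minimality. Starting below the norm lowered along d gives p (- d) <= - |d|;
    minimality makes p odd, and an odd sublinear functional is linear, so p d = |d|. *)
Lemma norming_functional (d : U) : exists a : dual U,
  sval a d = `|d| /\ forall x, `|sval a x| <= `|x|.
Proof.
have snorm : sublinear (@Num.Def.normr _ U).
  by split => [x y|c x c0]; [exact: ler_normD|rewrite normrZ gtr0_norm].
have [p sp [pq pmin]] := minimal_sublinear (lower_sublinear d snorm).
have [pD pZ] := sp.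
have pN x : p (- x) = - p x.
  apply/eqP; rewrite eq_le; apply/andP; split.
    apply: le_trans (lower_opp x sp).
    by apply: pmin; [exact: lower_sublinear|exact: lower_le_self].
  by have := pD x (- x); rewrite subrr sublinear0//; lra.
have pE x y : p (x + y) = p x + p y.
  apply/eqP; rewrite eq_le pD/=.
  by have := pD (- x) (- y); rewrite -opprD !pN; lra.
have pZ' c x : p (c *: x) = c * p x.
  have pos e z : 0 < e -> p (e *: z) = e * p z.
    move=> e0; apply/eqP; rewrite eq_le pZ//=.
    rewrite -ler_pdivlMl//; have := pZ e^-1 (e *: z).
    by rewrite scalerA mulVf ?gt_eqF// scale1r; apply; rewrite invr_gt0.
  have [c0|c0|<-] := ltgtP 0 c; first exact: pos.
    by rewrite -[in LHS](opprK c) scaleNr pN pos ?oppr_gt0// mulNr opprK.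
  by rewrite scale0r mul0r sublinear0.
have pnorm x : p x <= `|x| by rewrite (le_trans (pq x))//; exact: lower_le_self.
have pabs x : `|p x| <= `|x|.
  by rewrite ler_norml pnorm andbT lerNl -pN (le_trans (pnorm _))// normrN.
have linp : linear (p : U -> R^o).
  by move=> c x y; rewrite pE pZ'.
pose f : {linear U -> R^o} := HB.pack (p : U -> R^o) (GRing.isLinear.Build _ _ _ _ _ linp).
have cf : continuous f.
  move=> x; apply/cvgrPdist_le => e e0.
  apply/nbhs_ballP; exists e => //= y; rewrite -ball_normE /= => xy.
  have -> : p x - p y = p (x - y) by rewrite pE pN.
  by rewrite (le_trans (pabs _))// ltW.
have pd : p d = `|d|.
  apply/eqP; rewrite eq_le pnorm /= -[leRHS]opprK -pN lerNr.
  by rewrite (le_trans (pq _))//; exact: lower_opp.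
by exists (exist _ f cf).
Qed.

End norming_functional.

(** * Borel sets and cylinders *)

Section cylinder_algebra.
Context (R : realType) (U : normedModType R).

Lemma measurable_dual_proj n (a : 'I_n -> dual U) :
  measurable_fun [set: borel U] (dual_proj a : borel U -> borel 'rV[R]_n).
Proof. by apply: measurable_fun_borel; exact: dual_proj_continuous. Qed.

Lemma cylinder_borel (Z : set U) : cylinder setT Z -> measurable (Z : set (borel U)).
Proof.
move=> [n [a [B [_ mB ->]]]]; rewrite -[X in measurable X]setTI.
exact: measurable_dual_proj.
Qed.

Lemma cylinder_pair (Y Z : set U) : cylinder setT Y -> cylinder setT Z ->
  exists n (c : 'I_n -> dual U) (A B : set (borel 'rV[R]_n)),
    [/\ measurable A, measurable B, Y = dual_proj c @^-1` A &
      Z = dual_proj c @^-1` B].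
Proof.
move=> [n [a [A [_ mA ->]]]] [m [b [B [_ mB ->]]]].
pose c := dual_cat a b.
have cE u : dual_proj c u = row_mx (dual_proj a u) (dual_proj b u).
  exact: dual_proj_cat.
exists (n + m)%N, c, ((fun x => x *m col_mx 1%:M 0) @^-1` A),
  ((fun x => x *m col_mx 0 1%:M) @^-1` B); split.
- by rewrite -[X in measurable X]setTI; exact: measurable_mulmx.
- by rewrite -[X in measurable X]setTI; exact: measurable_mulmx.
- by apply/seteqP; split => u /=; rewrite cE mul_row_col mulmx1 mulmx0 addr0.
- by apply/seteqP; split => u /=; rewrite cE mul_row_col mulmx1 mulmx0 add0r.
Qed.

Lemma cylinderI : setI_closed (cylinder [set: dual U]).
Proof.
move=> Y Z cY cZ; have [n [c [A [B [mA mB -> ->]]]]] := cylinder_pair cY cZ.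
by exists n, c, (A `&` B); split => //; exact: measurableI.
Qed.

Lemma cylinderU : setU_closed (cylinder [set: dual U]).
Proof.
move=> Y Z cY cZ; have [n [c [A [B [mA mB -> ->]]]]] := cylinder_pair cY cZ.
by exists n, c, (A `|` B); split => //; exact: measurableU.
Qed.

Lemma cylinderC : setC_closed (cylinder [set: dual U]).
Proof.
move=> _ [n [a [B [_ mB ->]]]]; exists n, a, (~` B).
by split => //; exact: measurableC.
Qed.

Lemma cylinder0 : cylinder [set: dual U] set0.
Proof.
by exists 0, (@no_dual R U), set0; rewrite preimage_set0.
Qed.

Lemma cylinderT : cylinder [set: dual U] setT.
Proof. by rewrite -[X in cylinder _ X]setC0; exact: cylinderC cylinder0. Qed.

Lemma cylinder_slab (a : dual U) (y : U) (r : R) :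
  cylinder setT [set x | `|sval a (x - y)| <= r].
Proof.
have slE x : sval a (x - y) = sval a x - sval a y :> R by exact: linearB.
exists 1, (fun=> a), [set v : 'rV[R]_1 | `|v ord0 ord0 - sval a y| <= r].
split => //; last first.
  by apply/seteqP; split => x /=; rewrite mxE slE.
have cf : continuous (fun v : 'rV[R]_1 => `|v ord0 ord0 - sval a y|).
  have c1 : continuous (fun v : 'rV[R]_1 => v ord0 ord0 - sval a y).
    move=> v; apply: (@continuousB R R^o 'rV[R]_1 (fun v => v ord0 ord0)
      (cst (sval a y : R))); [exact: coord_continuous|exact: cst_continuous].
  by move=> v; apply: (continuous_comp (c1 v)); exact: norm_continuous.
have := measurable_continuous_borel cf measurableT (measurable_itv `]-oo, r]).
by rewrite setTI; congr measurable; apply/seteqP; split => v /=; rewrite in_itv.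
Qed.

End cylinder_algebra.

Section borel_trace.
Context (R : realType) (U : normedModType R) (L : nat -> set U).
Hypothesis cL : forall n, compact (L n).

Let dense_sequence : exists D : nat * nat * nat -> U,
  forall x e, (\bigcup_n L n) x -> 0 < e -> exists p, `|x - D p| < e.
Proof.
have fin n m : exists F : seq U, forall x, L n x ->
    exists2 y, y \in F & `|x - y| < m.+1%:R^-1.
  have := @cL n; rewrite compact_cover.
  move=> /(_ U setT (fun y => ball y m.+1%:R^-1))[].
  - by move=> y _; exact: ball_open.
  - by move=> x _; exists x => //; exact: ballxx.
  move=> F _ LF; exists (finmap.enum_fset F) => x /LF[y /= yF yx]; exists y => //.
  by move: yx; rewrite -ball_normE/= distrC.
have [F FP] := choice (fun nm : nat * nat => fin nm.1 nm.2).
(* The index consists of a compact set, a mesh and a position in the finite net. Beyond the end of a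
   net the value is 0, which is harmless since D may leave the union. *)
exists (fun p => nth 0 (F p.1) p.2) => x e [n _ Lx] e0.
have [y yF xy] := FP (n, Num.truncn e^-1) x Lx.
exists (n, Num.truncn e^-1, index y (F (n, Num.truncn e^-1))).
rewrite /= nth_index// (lt_trans xy)//= invf_plt ?posrE//.
by rewrite truncnS_gt.
Qed.

(* On a sigma-compact set, countably many norming functionals describe the
   closed balls. *)
Lemma borel_trace (A : set (borel U)) : measurable A ->
  exists2 A', (cylinder [set: dual U]).-sigma.-measurable A' &
    A `&` \bigcup_n L n = A' `&` \bigcup_n L n.
Proof.
set S := \bigcup_n L n; have [D DP] := dense_sequence.
have [f fP] := choice (fun pq : (nat * nat * nat) * (nat * nat * nat) =>
  norming_functional (D pq.1 - D pq.2)).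
pose T q r := \bigcap_p [set x | `|sval (f (p, q)) (x - D q)| <= r].
have mT q r : (cylinder [set: dual U]).-sigma.-measurable (T q r).
  rewrite -[X in measurable X]setCK; apply: measurableC; rewrite setC_bigcap.
  apply: (countable_bigcupT_measurable (countableP _)) => p.
  by apply: measurableC; apply: sub_sigma_algebra; exact: cylinder_slab.
have TP q r x : S x -> T q r x <-> `|x - D q| <= r.
  move=> Sx; split => [Tx|xr p _ /=]; last by rewrite (le_trans ((fP (p, q)).2 _)).
  rewrite leNgt; apply/negP => rx.
  (* Half of the excess over r, because the error |x - D p| enters twice: in [h4] through the
     functional and in [h5] through the triangle inequality. *)
  have e0 : 0 < (`|x - D q| - r) / 2 by rewrite divr_gt0// subr_gt0.
  have [p xp] := DP x _ Sx e0.
  have [/= h1 h2] := fP (p, q).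
  have := Tx p I; rewrite /= => h3.
  have h4 : `|D p - D q| <= `|sval (f (p, q)) (x - D q)| + `|x - D p|.
    rewrite -h1 (_ : D p - D q = (x - D q) - (x - D p)); last by rewrite opprB [RHS]addrC addrA subrK.
    rewrite linearB (le_trans (ler_norm _))// (le_trans (ler_normB _ _))//.
    by rewrite lerD2l.
  have h5 : `|x - D q| <= `|x - D p| + `|D p - D q|.
    by rewrite (le_trans _ (ler_normD _ _))// addrA subrK.
  lra.
move: A; pose H : set (set U) := [set A | exists2 A',
  (cylinder [set: dual U]).-sigma.-measurable A' & A `&` S = A' `&` S].
suff : (@measurable _ (borel U)) `<=` H by apply.
apply: smallest_sub; first split.
- by exists set0.
- move=> A [A' mA' AA']; exists (~` A'); first exact: measurableC.
  rewrite setTD; apply/seteqP; split => x [nx Sx]; split => // h; apply: nx.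
    by have [] : (A `&` S) x by rewrite AA'.
  by have [] : (A' `&` S) x by rewrite -AA'.
- move=> F HF.
  have /choice[F' F'P] : forall i, exists A',
      (cylinder [set: dual U]).-sigma.-measurable A' /\ F i `&` S = A' `&` S.
    by move=> i; have [A' mA' FA'] := HF i; exists A'.
  exists (\bigcup_i F' i); first by apply: bigcupT_measurable => i; exact: (F'P i).1.
  rewrite !setI_bigcupl; apply: eq_bigcupr => i _; exact: (F'P i).2.
move=> A oA.
pose ok (qm : (nat * nat * nat) * nat) :=
  `[< forall x, `|x - D qm.1| <= qm.2.+1%:R^-1 -> A x >].
exists (\bigcup_qm (if ok qm then T qm.1 qm.2.+1%:R^-1 else set0)).
  apply: (countable_bigcupT_measurable (countableP _)) => qm.
  by case: ifPn.
apply/seteqP; split => x [Ax Sx]; split => //; last first.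
  have [qm _] := Ax; case: ifPn => // /asboolP okx Tx.
  by apply: okx; apply/TP.
have /nbhs_ballP[e /= e0 eA] : nbhs x A by exact: open_nbhs_nbhs.
pose m := Num.truncn (2 / e).
have me : 2 * m.+1%:R^-1 < e.
  by rewrite -ltr_pdivlMr ?invr_gt0// invrK mulrC -ltr_pdivrMr// truncnS_gt.
have m0 : 0 < m.+1%:R^-1 :> R by rewrite invr_gt0.
have [q xq] := DP x _ Sx m0.
exists (q, m) => //; rewrite ifT; first by apply/TP => //; exact: ltW.
apply/asboolP => y /= yq; apply: eA; rewrite -ball_normE /=.
rewrite (_ : x - y = (x - D q) - (y - D q)); last by rewrite opprB addrA subrK.
apply: le_lt_trans (ler_normB _ _) _.
by rewrite (lt_trans (ltr_leD xq yq))// -mulr2n -[ltLHS]mulr_natl.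
Qed.

End borel_trace.

(** * Regularity of Borel probability measures *)

Section regularity.
Context (R : realType) (V : normedModType R) (mu : probability (borel V) R).
Local Open Scope ereal_scope.

Lemma nondecreasing_approx (A : set (borel V)) (F : nat -> set (borel V)) (e : R) :
  (0 < e)%R -> measurable A -> (forall n, measurable (F n)) ->
  nondecreasing_seq F -> A `<=` \bigcup_n F n -> exists n, mu (A `\` F n) < e%:E.
Proof.
move=> e0 mA mF ndF AF.
have mD n : measurable (A `\` F n) by exact: measurableD.
have cap0 : \bigcap_n (A `\` F n) = set0.
  apply/seteqP; split => // x h; have [Ax _] := h 0%N I.
  have [n _ Fnx] := AF x Ax.
  by have [_] := h n I.
have : mu (A `\` F n) @[n --> \oo] --> mu (\bigcap_n (A `\` F n)).
  apply: nonincreasing_cvg_mu => //.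
  - by rewrite (le_lt_trans (probability_le1 _ _))// ltry.
  - by rewrite cap0.
  - by move=> m n mn; apply/subsetPset; apply: setDS; exact/subsetPset/ndF.
rewrite cap0 measure0 => cvg0.
have e0' : 0 < e%:E by rewrite lte_fin.
have /cvg0[N _ NP] := open_ereal_lt' e0'.
by exists N; exact: (NP N (leqnn N)).
Qed.

(** The sets with this property form a sigma-algebra. For a union, half of e is shared among the
    members and half pays for truncating the union of closed sets, which need not be closed. An open
    set is the increasing union of the closed sets of points at distance at least 1/(n+1) from every
    point of its complement. *)
Lemma borel_regular (A : set (borel V)) : measurable A -> forall e : R, (0 < e)%R ->
  exists F G : set V, [/\ closed F, open G, F `<=` A, A `<=` G &
    mu (G `\` F) < e%:E].
Proof.
pose H : set (set V) := [set A | forall e : R, (0 < e)%R ->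
  exists F G : set V, [/\ closed F, open G, F `<=` A, A `<=` G &
    mu (G `\` F) < e%:E]].
suff : (@measurable _ (borel V)) `<=` H by move=> h mA; exact: h.
clear A; apply: smallest_sub; first split.
- move=> e e0; exists set0, set0; split; [exact: closed0|exact: open0|by []|by []|].
  by rewrite setD0 measure0 lte_fin.
- move=> B HB e e0; have [F [G [cF oG FB BG FG]]] := HB e e0.
  rewrite setTD; exists (~` G), (~` F); split.
  + exact: open_closedC.
  + exact: closed_openC.
  + exact: subsetC.
  + exact: subsetC.
  + by rewrite setDE setCK setIC.
- move=> B HB e e0.
  have ei i : (0 < e / (2 ^ i.+2)%:R)%R by rewrite divr_gt0// ltr0n expn_gt0.
  have /choice[FG FGP] : forall i, exists FG : set V * set V,
      [/\ closed FG.1, open FG.2, FG.1 `<=` B i, B i `<=` FG.2 &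
        mu (FG.2 `\` FG.1) < (e / (2 ^ i.+2)%:R)%:E].
    by move=> i; have [F [G h]] := HB i _ (ei i); exists (F, G).
  pose F i := (FG i).1; pose G i := (FG i).2.
  have cF i : closed (F i) by have [] := FGP i.
  have oG i : open (G i) by have [] := FGP i.
  have FB i : F i `<=` B i by have [] := FGP i.
  have BG i : B i `<=` G i by have [] := FGP i.
  have FGe i : mu (G i `\` F i) < (e / (2 ^ i.+2)%:R)%:E by have [] := FGP i.
  have mF i : measurable (F i : set (borel V)) by exact: closed_borel.
  have mG i : measurable (G i : set (borel V)) by exact: open_borel.
  pose Fu n := \big[setU/set0]_(i < n) F i.
  have mFu n : measurable (Fu n : set (borel V)) by exact: bigsetU_measurable.
  have e20 : (0 < e / 2)%R by rewrite divr_gt0.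
  have [n nP] : exists n, mu ((\bigcup_i F i) `\` Fu n) < (e / 2)%:E.
    apply: nondecreasing_approx => //.
    - by apply: bigcupT_measurable.
    - by move=> m n mn; apply/subsetPset; exact: subset_bigsetU.
    - move=> x [i _ Fix]; exists i.+1 => //; rewrite /Fu big_ord_recr.
      by right.
  exists (Fu n), (\bigcup_i G i); split.
  + rewrite /Fu; apply: closed_bigsetU => i _; exact: cF.
  + by apply: bigcup_open => i _; exact: oG.
  + by rewrite /Fu -bigcup_mkord => x [i _ Fix]; exists i => //; exact: FB.
  + by apply: subset_bigcup => i _; exact: BG.
  have mUG : measurable (\bigcup_i (G i `\` F i) : set (borel V)).
    by apply: bigcupT_measurable => i; exact: measurableD.
  have mUF : measurable ((\bigcup_i F i) `\` Fu n : set (borel V)).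
    by apply: measurableD => //; exact: bigcupT_measurable.
  apply: (@le_lt_trans _ _ (mu (\bigcup_i (G i `\` F i) `|` ((\bigcup_i F i) `\` Fu n)))).
    apply: le_measure; rewrite ?inE.
    - by apply: measurableD => //; exact: bigcupT_measurable.
    - exact: measurableU.
    - move=> x [[i _ Gix] nFx]; have [Fx|nF] := pselect ((\bigcup_i F i) x); first by right.
      by left; exists i => //; split => // Fix; apply: nF; exists i.
  apply: le_lt_trans (measureU2 _ mUG mUF) _.
  rewrite [X in _ < X%:E](splitr e) EFinD; apply: lee_ltD => //.
    exact: fin_num_measure.
  apply: (@le_trans _ _ (\sum_(i <oo) mu (G i `\` F i))).
    apply: measure_sigma_subadditive => //.
    by move=> i; exact: measurableD.
  apply: (@le_trans _ _ (\sum_(i <oo) ((e / 2) / (2 ^ i.+1)%:R)%:E)).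
    apply: lee_nneseries => // i _; rewrite ltW//.
    by rewrite -mulrA -invfM -natrM -expnS.
  exact: epsilon_trick0 (ltW e20).
- move=> A oA e e0; pose F n : set V := ~` \bigcup_(z in ~` A) ball z (n.+1%:R^-1)%R.
  have cF n : closed (F n).
    apply: open_closedC; apply: bigcup_open => z _; exact: ball_open.
  have FA n : F n `<=` A.
    move=> x Fx; apply: contrapT => nA; apply: Fx.
    by exists x => //; apply: ballxx; rewrite invr_gt0.
  have [n nP] : exists n, mu (A `\` F n) < e%:E.
    apply: nondecreasing_approx => //; first exact: open_borel.
    - by move=> n; exact: closed_borel.
    - move=> n m nm; apply/subsetPset => x Gx [z nAz zx]; apply: Gx.
      exists z => //; apply: le_ball zx.
      by rewrite lef_pV2 ?posrE// ler_nat.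
    - move=> x Ax; have /nbhs_ballP[d /= d0 dA] : nbhs x A by exact: open_nbhs_nbhs.
      exists (Num.truncn d^-1) => // -[z nAz zx]; apply/nAz/dA.
      apply/ball_sym; apply: le_ball zx.
      by rewrite invf_ple ?posrE// ltW// truncnS_gt.
  by exists (F n), A; split.
Qed.

Lemma tight_radon :
  (forall e : R, (0 < e)%R -> exists2 K : set V, compact K & mu (~` K) < e%:E) ->
  radon mu.
Proof.
move=> tight A mA e e0; have e20 : (0 < e / 2)%R by rewrite divr_gt0.
have [K cK Ke] := tight _ e20.
have [F [G [cF oG FA AG FGe]]] := borel_regular mA e20.
have mK := compact_borel cK.
have mF : measurable (F : set (borel V)) by exact: closed_borel.
have mG : measurable (G : set (borel V)) by exact: open_borel.
exists (F `&` K); split.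
- by rewrite setIC; apply: compact_closedI.
- by move=> x [Fx _]; exact: FA.
- have mGF : measurable (G `\` F : set (borel V)) by exact: measurableD.
  have mCK : measurable (~` K : set (borel V)) by exact: measurableC.
  apply: (@le_lt_trans _ _ (mu ((G `\` F) `|` ~` K))).
    apply: le_measure; rewrite ?inE.
    + by apply: measurableD => //; exact: measurableI.
    + exact: measurableU.
    + move=> x [Ax nFK]; have [Kx|nK] := pselect (K x); last by right.
      by left; split; [exact: AG|move=> Fx; apply: nFK].
  apply: le_lt_trans (measureU2 _ mGF mCK) _.
  by rewrite [X in _ < X%:E](splitr e) EFinD; apply: lteD.
Qed.

End regularity.

(** * Extension of tight cylindrical measures *)

(** A copy of U whose measurable sets are the cylinders, kept apart from the Borel structure so that
    [mu_ext] can be formed from the algebra. *)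
Definition cylinder_space (R : realType) (U : normedModType R) : Type := U.

Definition cylinder_display : measure_display.
Proof. by constructor. Qed.

HB.instance Definition _ (R : realType) (U : normedModType R) :=
  Pointed.on (cylinder_space U).

HB.instance Definition _ (R : realType) (U : normedModType R) :=
  @isAlgebraOfSets.Build cylinder_display (cylinder_space U)
    (cylinder [set: dual U]) (@cylinder0 R U) (@cylinderU R U) (@cylinderC R U).

Section premeasure.
Context d (T : semiRingOfSetsType d) (R : realType) (f : set T -> \bar R).
Hypotheses (f_ge0 : forall A, (0 <= f A)%E)
  (fD : measure_function.semi_additive f)
  (f_sub : measurable_subset_sigma_subadditive f).

Let content : {content set T -> \bar R} :=
  HB.pack f (isContent.Build _ _ _ f f_ge0 fD).

Definition premeasure : {measure set T -> \bar R} :=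
  HB.pack f (isMeasure.Build _ _ _ f (measure0 content) f_ge0
    (@semiring_sigma_additive _ _ _ content f_sub)).

End premeasure.

Section cylindrical_extension.
Context (R : realType) (U : normedModType R).
Variables (nu : cylindrical_probability U) (L : nat -> set U).
Hypothesis cL : forall n, compact (L n).
Hypothesis nuL : forall m n (a : 'I_n -> dual U) (B : set (borel 'rV[R]_n)),
  measurable B -> dual_proj a @^-1` B `&` L m = set0 ->
  (nu (dual_proj a @^-1` B) <= (m.+1%:R^-1)%:E)%E.
Local Open Scope ereal_scope.

Let S := \bigcup_n L n.

Lemma cylindrical_additive (Y Z : set U) : cylinder setT Y -> cylinder setT Z ->
  Y `&` Z = set0 -> nu (Y `|` Z) = nu Y + nu Z.
Proof.
move=> cY cZ; have [n [c [A [B [mA mB -> ->]]]]] := cylinder_pair cY cZ => AB0.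
(* The bases may overlap outside the range of the projection; removing A from B makes them disjoint
   without changing the cylinder. *)
have -> : dual_proj c @^-1` B = dual_proj c @^-1` (B `\` A).
  apply/seteqP; split => u /= => [Bu|[]//]; split => // Au.
  by have : (dual_proj c @^-1` A `&` dual_proj c @^-1` B) u by []; rewrite AB0.
rewrite -preimage_setU.
apply: (measureU (cylindrical_image nu c) mA (measurableD mB mA)).
by rewrite setDE setICA setICr setI0.
Qed.

Lemma cylindrical0 : nu set0 = 0.
Proof.
rewrite -(preimage_set0 (dual_proj (@no_dual R U))).
exact: (measure0 (cylindrical_image nu (@no_dual R U))).
Qed.

Lemma cylindrical_setC (Z : set U) : cylinder setT Z -> nu Z + nu (~` Z) = 1.
Proof.
move=> cZ; rewrite -cylindrical_additive ?setICr//; last exact: cylinderC.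
by rewrite setUCr cylindrical_setT.
Qed.

Lemma cylindrical_fin_num (Z : set U) : cylinder setT Z -> nu Z \is a fin_num.
Proof.
move=> cZ; rewrite ge0_fin_numE ?cylindrical_ge0//.
apply: (@le_lt_trans _ _ 1); last exact: ltry.
by rewrite -(cylindrical_setC cZ) leeDl// cylindrical_ge0.
Qed.

Lemma le_cylindrical (Y Z : set U) : cylinder setT Y -> cylinder setT Z ->
  Y `<=` Z -> nu Y <= nu Z.
Proof.
move=> cY cZ YZ; rewrite -(setDUK YZ) cylindrical_additive ?leeDl ?cylindrical_ge0//.
  by rewrite setDE; apply: cylinderI => //; exact: cylinderC.
by rewrite setDE setICA setICr setI0.
Qed.

Lemma cylindrical_subadditive (Y Z : set U) : cylinder setT Y -> cylinder setT Z ->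
  nu (Y `|` Z) <= nu Y + nu Z.
Proof.
move=> cY cZ; have cZY : cylinder setT (Z `\` Y).
  by rewrite setDE; apply: cylinderI => //; exact: cylinderC.
have -> : Y `|` Z = Y `|` (Z `\` Y).
  apply/seteqP; split => x; last by move=> [Yx|[Zx _]]; [left|right].
  by have [Yx|nY] := pselect (Y x); [left|move=> [//|Zx]; right].
rewrite cylindrical_additive//; last by rewrite setDE setICA setICr setI0.
by rewrite leeD2l// le_cylindrical// => x [].
Qed.

(** Regularity of a single finite-dimensional image. Open cylinders are what compactness of [L m]
    can act on. *)
Lemma cylindrical_open_approx (Z : set U) (e : R) : (0 < e)%R -> cylinder setT Z ->
  exists W : set U, [/\ open W, cylinder setT W, Z `<=` W & nu W <= nu Z + e%:E].
Proof.
move=> e0 [n [a [B [_ mB ->]]]].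
have [F [G [cF oG FB BG FGe]]] := borel_regular (cylindrical_image nu a) mB e0.
have mG : measurable (G : set (borel 'rV[R]_n)) by exact: open_borel.
have mF : measurable (F : set (borel 'rV[R]_n)) by exact: closed_borel.
exists (dual_proj a @^-1` G); split.
- by have /continuousP cp := @dual_proj_continuous R U n a; exact: cp.
- by exists n, a, G.
- by move=> u /BG.
have -> : nu (dual_proj a @^-1` G) = cylindrical_image nu a (F `|` (G `\` F)).
  by rewrite setDUK//; exact: subset_trans BG.
apply: le_trans (measureU2 _ mF (measurableD mG mF)) _.
by apply: leeD; [apply: (le_measure (cylindrical_image nu a)); rewrite ?inE|exact: ltW].
Qed.

(** Open enlargements cost e/2 in total. Finitely many cover a compact [L m], and the cylinder they
    leave over misses [L m], so it has measure at most e/2. Covering S alone suffices, and this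
    yields both countable subadditivity and full outer measure of S. *)
Lemma cylindrical_cover_ge1 (F : nat -> set U) :
  (forall i, cylinder setT (F i)) -> S `<=` \bigcup_i F i ->
  1 <= \sum_(i <oo) nu (F i).
Proof.
move=> cF SF; apply/lee_addgt0Pr => e e0.
have e20 : (0 < e / 2)%R by rewrite divr_gt0.
have /choice[W WP] : forall i, exists W : set U, [/\ open W, cylinder setT W,
    F i `<=` W & nu W <= nu (F i) + (e / 2 / (2 ^ i.+1)%:R)%:E].
  by move=> i; apply: cylindrical_open_approx => //; rewrite divr_gt0// ltr0n expn_gt0.
pose Y n := \big[setU/set0]_(i < n) W i.
have cY n : cylinder setT (Y n).
  rewrite /Y; elim/big_ind : _ => [|A B|i _]; [exact: cylinder0|exact: cylinderU|].
  by have [] := WP i.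
have nuY n : nu (Y n) <= \sum_(i < n) nu (W i).
  elim: n => [|n ih]; first by rewrite /Y !big_ord0 cylindrical0.
  rewrite /Y !big_ord_recr/=.
  have [_ cW _ _] := WP n.
  by rewrite (le_trans (cylindrical_subadditive (cY n) cW))// leeD2r.
pose m := Num.truncn (e / 2)^-1.
have me : (m.+1%:R^-1 <= e / 2 :> R)%R.
  by rewrite invf_ple ?posrE// ltW// truncnS_gt.
have [N LN] : exists N, L m `<=` Y N.
  have := @cL m; rewrite compact_cover => /(_ nat setT W)[].
  - by move=> i _; have [] := WP i.
  - move=> x Lx; have [i _ Fix] := SF x (ex_intro2 _ _ m I Lx).
    by exists i => //; have [_ _ FW _] := WP i; exact: FW.
  move=> D _ LD; exists (\max_(i <- finmap.enum_fset D) i).+1 => x /LD[i /= iD Wix].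
  rewrite /Y -bigcup_mkord; exists i => //=; rewrite ltnS.
  by apply: leq_bigmax_seq.
have nuC : nu (~` Y N) <= (e / 2)%:E.
  have [n [a [B [_ mB YE]]]] := cylinderC (cY N).
  apply: (@le_trans _ _ (m.+1%:R^-1)%:E); last by rewrite lee_fin.
  rewrite YE; apply: nuL => //; rewrite -YE.
  by apply/seteqP; split => // x [nY /LN].
rewrite -(cylindrical_setC (cY N)) (splitr e) EFinD addeA.
apply: leeD => //; apply: (le_trans (nuY N)).
apply: (@le_trans _ _ (\sum_(i < N) (nu (F i) + (e / 2 / (2 ^ i.+1)%:R)%:E))).
  by apply: lee_sum => i _; have [] := WP i.
rewrite -(big_mkord xpredT (fun i => nu (F i) + (e / 2 / (2 ^ i.+1)%:R)%:E)).
apply: (@le_trans _ _ (\sum_(i <oo) (nu (F i) + (e / 2 / (2 ^ i.+1)%:R)%:E))).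
  apply: nneseries_lim_ge => i _ _.
  by rewrite adde_ge0 ?cylindrical_ge0// lee_fin divr_ge0// ltW.
by apply: epsilon_trick; [move=> i; exact: cylindrical_ge0|exact: ltW].
Qed.

Local Notation T := (cylinder_space U).
Let nu' : set T -> \bar R := nu.

Let nu'_ge0 A : 0 <= nu' A.
Proof. exact: cylindrical_ge0. Qed.

Let nu'_semi_additive : measure_function.semi_additive nu'.
Proof.
apply/additive2P; first exact: cylindrical0.
by move=> A B mA mB AB; exact: cylindrical_additive.
Qed.

Let nu'_sigma_subadditive : measurable_subset_sigma_subadditive nu'.
Proof.
move=> A F mF mA AF.
(* With the complement of A added as a first member the sets cover the whole space; the finite
   measure of this complement is then cancelled. *)
pose F' i := if i is j.+1 then F j else ~` A.
have cF' i : cylinder setT (F' i) by case: i => [|i]; [exact: cylinderC|exact: mF].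
have SF' : S `<=` \bigcup_i F' i.
  move=> x _; have [Ax|nA] := pselect (A x); last by exists 0%N.
  by have [i _ Fx] := AF x Ax; exists i.+1.
have : 1 <= nu (~` A) + \sum_(i <oo) nu (F i).
  have := cylindrical_cover_ge1 cF' SF'.
  rewrite [X in 1 <= X -> _]nneseries_recl//.
  rewrite -(@nneseries_addn _ (fun i => nu (F' i)) 1); last first.
    by move=> i; exact: cylindrical_ge0.
  rewrite (eq_eseriesr (f := fun i => nu (F' (i + 1)%N)) (g := fun i => nu (F i)))//.
  by move=> i _; rewrite addn1.
rewrite -(cylindrical_setC mA) addeC leeD2lE//.
exact: cylindrical_fin_num (cylinderC mA).
Qed.

Let nup : {measure set T -> \bar R} :=
  premeasure nu'_ge0 nu'_semi_additive (@nu'_sigma_subadditive).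

Let nupE (Z : set T) : nup Z = nu Z.
Proof. by []. Qed.

(** The intersection with S makes Borel sets Caratheodory measurable, since on S they agree with
    sets of the cylindrical sigma-algebra. S itself may lie outside that sigma-algebra, but its
    outer measure is 1, so no mass is lost. *)
Let outer (X : set U) : \bar R := mu_ext nup (X `&` S).

Let outer0 : outer set0 = 0.
Proof. by rewrite /outer set0I outer_measure0. Qed.

Let outer_ge0 X : 0 <= outer X.
Proof. exact: outer_measure_ge0. Qed.

Let outer_le : {homo outer : A B / A `<=` B >-> A <= B}.
Proof. by move=> A B AB; apply: le_outer_measure; exact: setSI. Qed.

Let outer_sigma_subadditive : sigma_subadditive outer.
Proof.
by move=> F; rewrite /outer setI_bigcupl; exact: outer_measure_sigma_subadditive.
Qed.

Let outer_measure : {outer_measure set U -> \bar R} :=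
  HB.pack outer (isOuterMeasure.Build _ _ outer outer0 outer_ge0 outer_le
    outer_sigma_subadditive).

Let borel_caratheodory (A : set (borel U)) : measurable A ->
  outer_measure.-caratheodory A.
Proof.
move=> mA X; have [A' mA' AS] := borel_trace cL mA.
change (outer X = outer (X `&` A) + outer (X `&` ~` A)); rewrite /outer.
rewrite [LHS](@sub_caratheodory _ T R nup A' mA' (X `&` S)).
congr (_ + _); apply: (f_equal (mu_ext nup)).
  by rewrite -!setIA [_ `&` A']setIC AS.
apply/seteqP; split => x [[Xx h1] h2].
  do 2!split => //; move=> Ax.
  by have : (A `&` S) x by []; rewrite AS => -[].
split => // A'x.
by have : (A' `&` S) x by []; rewrite -AS => -[].
Qed.

Let outer_setT : outer setT = 1.
Proof.
rewrite /outer setTI; apply/eqP; rewrite eq_le; apply/andP; split.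
  rewrite -(@cylindrical_setT _ _ nu) -nupE -(@measurable_mu_extE _ R T nup).
    exact: le_outer_measure.
  exact: cylinderT.
apply: le_ereal_inf_tmp => _ [F [cF SF] <-].
exact: cylindrical_cover_ge1.
Qed.

Lemma cylindrical_extension : exists m : probability (borel U) R,
  (forall Z, cylinder setT Z -> m Z = nu Z) /\ m (~` \bigcup_n L n) = 0.
Proof.
have outer_sigma_additive : semi_sigma_additive (outer : set (borel U) -> \bar R).
  move=> F mF tF mUF.
  apply: (@caratheodory_measure_sigma_additive R U outer_measure) => //.
  - by move=> i; exact: borel_caratheodory.
  - exact: borel_caratheodory.
pose m1 : {measure set (borel U) -> \bar R} := HB.pack (outer : set (borel U) -> \bar R)
  (isMeasure.Build _ _ _ (outer : set (borel U) -> \bar R) outer0 outer_ge0 outer_sigma_additive).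
pose m2 : probability (borel U) R := HB.pack (outer : set (borel U) -> \bar R) m1
  (Measure_isProbability.Build _ _ _ m1 outer_setT).
have le_outer (Z : set U) : cylinder setT Z -> outer Z <= nu Z.
  move=> cZ; rewrite -nupE -(@measurable_mu_extE _ R T nup)//.
  by apply: le_outer_measure => x [].
exists m2; split => [Z cZ|]; last first.
  transitivity (mu_ext nup set0); last exact: outer_measure0.
  by apply: (f_equal (mu_ext nup)); exact: setICl.
(* The reverse inequality is [le_outer] for the complement of Z, as both set functions have total
   mass 1. *)
apply/eqP; rewrite eq_le [X in X && _]le_outer//=.
have h1 : 1 - m2 Z <= nu (~` Z).
  rewrite -(probability_setC m2); last exact: cylinder_borel.
  by apply: le_outer; exact: cylinderC.
have fm : m2 Z \is a fin_num by apply: fin_num_measure; exact: cylinder_borel.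
have h2 := cylindrical_setC cZ; have fz := cylindrical_fin_num cZ.
have fy := cylindrical_fin_num (cylinderC cZ).
rewrite -[leRHS]/(m2 Z); move: fm fz fy h1 h2.
case: (m2 Z) => // x _; case: (nu Z) => // z _; case: (nu (~` Z)) => // y _.
by rewrite -EFinB -EFinD !lee_fin => h [] e; lra.
Qed.

End cylindrical_extension.

(** * Radon roots *)

Section sigma_tight.
Context (R : realType) (V : normedModType R).
Implicit Types mu : probability (borel V) R.
Local Open Scope ereal_scope.

(** Equivalent to [radon] by the lemmas below, and easier to carry through convolutions: sumsets of
    compact sets are compact. *)
Definition sigma_tight mu :=
  exists2 L : nat -> set V, (forall n, compact (L n)) & mu (\bigcup_n L n) = 1.

Lemma measurable_sigma_compact (L : nat -> set V) : (forall n, compact (L n)) ->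
  measurable (\bigcup_n L n : set (borel V)).
Proof. by move=> cL; apply: bigcupT_measurable => n; exact: compact_borel. Qed.

Lemma radon_sigma_tight mu : radon mu -> sigma_tight mu.
Proof.
move=> rmu.
have /choice[K KP] : forall n : nat, exists K : set V,
    compact K /\ mu (~` K) < (n.+1%:R^-1)%:E.
  move=> n; have n0 : (0 < n.+1%:R^-1 :> R)%R by rewrite invr_gt0.
  by have [K [cK _]] := rmu setT measurableT _ n0; rewrite setTD => h; exists K.
have cK n : compact (K n) by have [] := KP n.
exists K => //; have mS := measurable_sigma_compact cK.
have SC0 : mu (~` \bigcup_n K n) = 0.
  apply/eqP; rewrite -measure_le0; apply/lee_addgt0Pr => e e0; rewrite add0e.
  have [_ /ltW h] := KP (Num.truncn e^-1).
  apply: (@le_trans _ _ (mu (~` K (Num.truncn e^-1)))).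
    apply: le_measure; rewrite ?inE; [exact: measurableC| |].
      by apply: measurableC; exact: compact_borel.
    by apply: subsetC; exact: bigcup_sup.
  apply: (le_trans h); rewrite lee_fin invf_ple ?posrE//.
  by rewrite ltW// truncnS_gt.
have : mu (~` ~` \bigcup_n K n) = 1 - mu (~` \bigcup_n K n).
  by apply: probability_setC; exact: measurableC.
by rewrite setCK SC0 sube0.
Qed.

Lemma sigma_tight_radon mu : sigma_tight mu -> radon mu.
Proof.
move=> [L cL L1]; apply: tight_radon => e e0.
have mS := measurable_sigma_compact cL.
pose F n : set V := \big[setU/set0]_(i < n) L i.
have cF n : compact (F n).
  rewrite /F; elim/big_ind : _ => [|A B|i _]; [exact: compact0|exact: compactU|exact: cL].
have mF n : measurable (F n : set (borel V)) by exact: compact_borel.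
have [n nP] : exists n, mu ((\bigcup_n L n) `\` F n) < e%:E.
  apply: nondecreasing_approx => //.
  - by move=> n m nm; apply/subsetPset; exact: subset_bigsetU.
  - by move=> x [i _ Lx]; exists i.+1 => //; rewrite /F big_ord_recr; right.
exists (F n) => //; apply: le_lt_trans nP.
have SC0 : mu (~` \bigcup_n L n) = 0 by rewrite probability_setC// L1 subee.
have mD : measurable ((\bigcup_n L n) `\` F n : set (borel V)) by exact: measurableD.
rewrite -[leRHS]adde0 -SC0; apply: le_trans (measureU2 _ mD (measurableC mS)).
apply: le_measure; rewrite ?inE; [exact: measurableC| |].
  by apply: measurableU => //; exact: measurableC.
move=> x nFx; have [Lx|] := pselect ((\bigcup_n L n) x); last by right.
by left.
Qed.

Lemma convolution_sigma_tight mu1 mu2 : sigma_tight mu1 -> sigma_tight mu2 ->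
  sigma_tight (convolution mu1 mu2).
Proof.
move=> [L1 cL1 h1] [L2 cL2 h2].
pose L (k : nat) : set V := if (unpickle k : option (nat * nat)) is Some (i, j)
  then [set x + y | x in L1 i & y in L2 j]%R else set0.
have cL k : compact (L k).
  rewrite /L; case: unpickle => [[i j]|]; last exact: compact0.
  exact: compact_sumset.
exists L => //; have mS := measurable_sigma_compact cL.
apply/eqP; rewrite eq_le probability_le1//=.
rewrite -[leLHS]mul1e -[X in X * _]h1 -[X in _ * X]h2.
apply: convolution_sumset => //; try exact: measurable_sigma_compact.
move=> x y [i _ Lx] [j _ Ly]; exists (pickle (i, j)) => //.
by rewrite /L pickleK; exists x => //; exists y.
Qed.

Lemma convolution_power_sigma_tight k mu : sigma_tight mu ->
  sigma_tight (convolution_power k mu).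
Proof.
move=> tmu; rewrite /convolution_power; elim: k.-1 => //= n ih.
exact: convolution_sigma_tight.
Qed.

(** Cylinders form a pi-system but may generate too few sets. On a sigma-compact set carrying both
    measures, however, every Borel set has the same trace as a set of the generated
    sigma-algebra. *)
Lemma sigma_tight_unique mu nu : sigma_tight mu -> sigma_tight nu ->
  (forall Z, cylinder [set: dual V] Z -> mu Z = nu Z) ->
  forall A : set (borel V), measurable A -> mu A = nu A.
Proof.
move=> [L1 cL1 h1] [L2 cL2 h2] munu A mA.
pose L n := L1 n `|` L2 n.
have cL n : compact (L n) by exact: compactU.
have mL := measurable_sigma_compact cL.
have full (m : probability (borel V) R) (K : nat -> set V) : (forall n, compact (K n)) ->
    m (\bigcup_n K n) = 1 -> (forall n, K n `<=` L n) ->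
    forall B : set (borel V), measurable B -> m B = m (B `&` \bigcup_n L n).
  move=> cK mK KL B mB; apply/eqP; rewrite eq_le; apply/andP; split; last first.
    by apply: le_measure; rewrite ?inE//; exact: measurableI.
  have mKS := measurable_sigma_compact cK.
  have C0 : m (~` \bigcup_n K n) = 0 by rewrite probability_setC// mK subee.
  have mI : measurable (B `&` \bigcup_n L n : set (borel V)) by exact: measurableI.
  rewrite -[leRHS]adde0 -C0; apply: le_trans (measureU2 _ mI (measurableC mKS)).
  apply: le_measure; rewrite ?inE//.
    by apply: measurableU => //; exact: measurableC.
  move=> x Bx; have [[n _ Kx]|] := pselect ((\bigcup_n K n) x); last by right.
  by left; split=> //; exists n => //; exact: KL.
have [A' mA' AS] := borel_trace cL mA.
have mA'b : measurable (A' : set (borel V)).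
  move: A' mA' {AS}; apply: smallest_sub; first exact: sigma_algebra_measurable.
  exact: cylinder_borel.
rewrite (full mu L1 cL1 h1) //; last by move=> n; exact: subsetUl.
rewrite (full nu L2 cL2 h2) //; last by move=> n; exact: subsetUr.
rewrite AS -(full mu L1 cL1 h1) //; last by move=> n; exact: subsetUl.
rewrite -(full nu L2 cL2 h2) //; last by move=> n; exact: subsetUr.
have mG : cylinder [set: dual V] `<=` (@measurable _ (borel V)).
  by move=> Z; exact: cylinder_borel.
apply: (g_sigma_algebra_measure_unique (T := borel V) _ mG (fun=> setT)) => //.
- by move=> _; exact: cylinderT.
- by rewrite bigcup_const.
- exact: cylinderI.
- by move=> _; rewrite [ltLHS](_ : _ = 1) ?ltry//; exact: probability_setT.
Qed.

End sigma_tight.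

Lemma cylindrical_restriction (R : realType) (U : normedModType R)
    (mu : probability (borel U) R) :
  exists nu : cylindrical_probability U, forall Z, nu Z = mu Z.
Proof.
have mu_measure (G : set (dual U)) : finite_set G ->
    exists m : {measure set (g_sigma_algebraType (cylinder G)) -> \bar R},
      forall Z, (cylinder G).-sigma.-measurable Z -> mu Z = m Z.
  move=> _; have mid : measurable_fun [set: borel U]
      (id : borel U -> g_sigma_algebraType (cylinder G)).
    move=> _ Z mZ; rewrite setTI preimage_id; move: Z mZ.
    apply: smallest_sub; first exact: sigma_algebra_measurable.
    by move=> _ [n [a [B [_ mB ->]]]]; apply: cylinder_borel; exists n, a, B.
  have [m mE] := image_probability mu mid.
  by exists m => Z _; rewrite [RHS]mE.
by exists (CylindricalProbability (measure_ge0 mu) mu_measure (probability_setT mu)).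
Qed.

Lemma radon_infinitely_divisibleP (R : realType) (U : normedModType R)
    (mu : probability (borel U) R) : radon mu ->
  (radon_infinitely_divisible mu <->
   forall (n : nat) (a : 'I_n -> dual U),
     infinitely_divisible (distribution mu (borel_proj a))).
Proof.
move=> rmu; split=> [idmu n a k k0|idmu k k0].
  have [nu [_ nuE]] := idmu k k0; exists (distribution nu (borel_proj a)) => B mB.
  have mpB : measurable (dual_proj a @^-1` B : set (borel U)).
    by rewrite -[X in measurable X]setTI; exact: measurable_dual_proj.
  transitivity (convolution_power k nu (dual_proj a @^-1` B)); first exact: nuE.
  apply/esym; apply: (convolution_power_pushforward (measurable_dual_proj a)) => //.
  exact: dual_projD.
have [cmu cmuE] := cylindrical_restriction mu.
have wid : weakly_infinitely_divisible cmu.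
  move=> n a j j0; have [nu nuE] := idmu n a j j0.
  by exists nu => A mA; rewrite -nuE//; exact: cmuE.
have [nu [_ nuE]] := cylindrical_root_exists wid k0.
have muE n (a : 'I_n -> dual U) (B : set (borel 'rV[R]_n)) : measurable B ->
    mu (dual_proj a @^-1` B) = convolution_power k (cylindrical_image nu a) B.
  by move=> mB; rewrite -cmuE nuE ?cylindrical_image_power//; exists n, a, B.
have /choice[L LP] : forall m : nat, exists L : set U, compact L /\
    forall n (a : 'I_n -> dual U) (B : set (borel 'rV[R]_n)), measurable B ->
      dual_proj a @^-1` B `&` L = set0 ->
      (nu (dual_proj a @^-1` B) <= (m.+1%:R^-1)%:E)%E.
  move=> m; have m0 : 0 < m.+1%:R^-1 :> R by rewrite invr_gt0.
  by have [L cL LP] := cylindrical_root_tight k0 rmu muE m0; exists L.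
have cL m : compact (L m) := (LP m).1.
have [m [mE mL0]] := cylindrical_extension cL (fun m => (LP m).2).
have tm : sigma_tight m.
  exists L => //; have : m (~` ~` \bigcup_n L n) = (1 - m (~` \bigcup_n L n))%E.
    by apply: probability_setC; apply: measurableC; exact: measurable_sigma_compact.
  by rewrite setCK mL0 sube0.
exists m; split; first exact: sigma_tight_radon.
(* The k-th power of m is known to equal mu only on cylinders; both being carried by sigma-compact
   sets, the equality extends to Borel sets. *)
apply: sigma_tight_unique; first exact: radon_sigma_tight.
  exact: convolution_power_sigma_tight.
move=> _ [n [a [B [_ mB ->]]]]; rewrite muE//.
apply: (convolution_power_pushforward (measurable_dual_proj a)) => //.
  exact: dual_projD.
by move=> A mA; apply/esym/mE; exists n, a, A.
Qed.

Theorem theorem3p13 (R : realType) (U : completeNormedModType R) :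
  (forall mu : cylindrical_probability U,
     cylindrical_infinitely_divisible mu <-> weakly_infinitely_divisible mu) /\
  (forall mu : probability (borel U) R, radon mu ->
     (radon_infinitely_divisible mu <->
      forall (n : nat) (a : 'I_n -> dual U),
        infinitely_divisible (distribution mu (borel_proj a)))).
Proof.
split=> [mu|mu]; first exact: cylindrical_infinitely_divisibleP.
exact: radon_infinitely_divisibleP.
Qed.
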